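(* Suppose (D1), (D2) hold and (SNR1) $n\,m^{-1}\|\mu_1-\mu_2\|_2^2\to\infty$ as $n\to\infty$. Then $$n\|\mu_1-\mu_2\|_2^2\,(\hat\tau_{n,\mathrm{LSE}}-\tau_n)=O_P(1).$$
   Context: For each $n$ we observe $m=m(n)$ series $\{X_{kt}:1\le k\le m,1\le t\le n\}$ with a common change point $\tau_n$, $0<c^*<\tau_n<1-c^*<1$ for a fixed $c^*>0$. Times $n\tau_n$ and $nb$ are integers ($\tau_n$ and candidates $b$ lie in $\{1/n,\dots,1\}$). A process $\{Y_t:t\in\mathbb Z\}$ is centered $4$-order stationary if $E(Y_t)=0$, $E|Y_t|^r<\infty$ for $r\le4$, and for $r=1,2,3,4$ the joint cumulant $\mathrm{Cum}(Y_{t_1},\dots,Y_{t_r})$ depends only on the lags $t_2-t_1,\dots,t_r-t_1$. (D1) $X_{kt}=\mu_{1k}I(t\le n\tau_n)+\mu_{2k}I(t>n\tau_n)+Y_{kt}$, where for each $k$, $\{Y_{kt}:t\in\mathbb Z\}$ is a centered $4$-order stationary process (unobserved), the processes are independent over $k$, and $\{Y_{kt}\}$ do not depend on $n$; the means $\mu_{ik}=\mu_{ik}(n)$ may depend on $n$, with $\mu_{1k}\ne\mu_{2k}$ for at least one $k$. (D2) $\sum_{t_1,\dots,t_r\in\mathbb Z}\sup_k|\mathrm{Cum}(Y_{k1},Y_{k(t_1+1)},\dots,Y_{k(t_r+1)})|<\infty$ for $r=1,2,3$. $\mu_i=(\mu_{i1},\dots,\mu_{im})$ and $\|\cdot\|_2$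 is the Euclidean norm. Least squares estimator: $\hat\tau_{n,\mathrm{LSE}}=\arg\max_{b\in(c^*,1-c^* )}M_n(b)$, with $$M_n(b)=-\frac1n\sum_{k=1}^m\Big[\sum_{t=1}^{nb}(X_{kt}-\hat\mu_{1k}(b))^2+\sum_{t=nb+1}^{n}(X_{kt}-\hat\mu_{2k}(b))^2\Big],$$ $\hat\mu_{1k}(b)=\frac1{nb}\sum_{t=1}^{nb}X_{kt}$, $\hat\mu_{2k}(b)=\frac1{n(1-b)}\sum_{t=nb+1}^nX_{kt}$. *)

(* Defs.v *)
From HB Require Import structures.
From mathcomp Require Import all_boot all_order all_algebra.
From mathcomp Require Import finmap.
From mathcomp Require Import all_classical all_reals all_analysis.

Set Implicit Arguments.
Unset Strict Implicit.
Unset Printing Implicit Defensive.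

Import Order.TTheory GRing.Theory Num.Theory.
Import numFieldNormedType.Exports.

Local Open Scope classical_set_scope.
Local Open Scope ring_scope.

(* Sum over the partitions pi of the index set, the blocks B of pi carrying
   the mixed moments:
     Cum(X_1, ..., X_r) =
       \sum_pi (-1)^(|pi| - 1) (|pi| - 1)! \prod_(B in pi) E(\prod_(i in B) X_i).
   [fine] is harmless when all the X_i have finite r-th absolute moments. *)
Definition cumulant d (T : measurableType d) (R : realType)
    (P : probability T R) (r : nat) (X : 'I_r -> T -> R) : R :=
  \sum_(pi : {set {set 'I_r}} | finset.partition pi [set: 'I_r]%SET)
    (-1) ^+ #|pi|.-1 * (#|pi|.-1)`!%:R *
    \prod_(B in pi) fine 'E_P[fun w => \prod_(i in B) X i w].

Definition centered_4th_order_stationary d (T : measurableType d)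
    (R : realType) (P : probability T R) (Y : int -> {RV P >-> R}) : Prop :=
  [/\ forall t, ('E_P[Y t] = 0)%E,
      forall t r, (r <= 4)%N -> ('E_P[fun w => (`|Y t w| ^+ r)%R] < +oo)%E
    & forall r, (r < 4)%N -> forall t u : 'I_r.+1 -> int,
        (forall i, t i - t ord0 = u i - u ord0) ->
        cumulant P (fun i => Y (t i)) = cumulant P (fun i => Y (u i))].

Definition process_sigma_algebra d (T : measurableType d) (R : realType)
    (Y : int -> T -> R) : set (set T) :=
  <<s \bigcup_t g_sigma_algebra_preimage (Y t) >>.

Definition independent_processes d (T : measurableType d) (R : realType)
    (P : probability T R) (Y : nat -> int -> {RV P >-> R}) : Prop :=
  forall (J : {fset nat}) (A : nat -> set T),
    (forall k, k \in J -> process_sigma_algebra (fun t => Y k t) (A k)) ->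
    P (\bigcap_(k in [set` J]) A k) = (\prod_(k <- J) P (A k))%E.

Definition euclidean_norm (R : realType) (m : nat) (v : 'rV[R]_m) : R :=
  Num.sqrt (\sum_(k < m) v 0 k ^+ 2).

Definition time_grid (R : realType) (n : nat) : set R :=
  [set b | exists2 j : nat, (0 < j <= n)%N & b = j%:R / n%:R].

(* The k-th observed series, k < m n, is driven by Y k.  Indexing the noise
   processes by all of nat is no restriction when m is bounded: the unused
   ones may be taken identically 0.
   The n-dependent clauses are only required for n large, since for small n
   (n = 1, for instance) no point of the grid lies in (c, 1 - c). *)
Definition D1 d (T : measurableType d) (R : realType) (P : probability T R)
    (c : R) (m : nat -> nat) (tau : nat -> R)
    (mu1 mu2 : forall n, 'rV[R]_(m n)) (Y : nat -> int -> {RV P >-> R})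
    (X : forall n, 'I_(m n) -> nat -> {RV P >-> R}) : Prop :=
  [/\ forall k, centered_4th_order_stationary (Y k),
      independent_processes Y
    & \forall n \near \oo,
      [/\ time_grid n (tau n) /\ c < tau n < 1 - c,
          exists k, mu1 n 0 k != mu2 n 0 k
        & forall k t w, (1 <= t <= n)%N ->
            X n k t w = mu1 n 0 k * (t%:R <= n%:R * tau n)%R%:R
                        + mu2 n 0 k * (n%:R * tau n < t%:R)%R%:R
                        + Y (k : nat) (t : int) w]].

Definition D2 d (T : measurableType d) (R : realType) (P : probability T R)
    (Y : nat -> int -> {RV P >-> R}) : Prop :=
  forall r, (1 <= r <= 3)%N ->
    (\esum_(t in [set: r.-tuple int])
       ereal_sup (range (fun k : nat =>
         (`|cumulant P (fun i => Y k (tnth [tuple of 0 :: t] i + 1))|)%R%:E))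
     < +oo)%E.

(* In the following definitions n * b is an integer, and the time t ranges
   over 1, ..., n * b or n * b + 1, ..., n; x is one realization x_t of a
   series, or x_kt of the panel. *)
Definition left_mean (R : realType) (n : nat) (x : nat -> R) (b : R) : R :=
  (n%:R * b)^-1 * \sum_(1 <= t < n.+1 | t%:R <= n%:R * b) x t.

Definition right_mean (R : realType) (n : nat) (x : nat -> R) (b : R) : R :=
  (n%:R * (1 - b))^-1 * \sum_(1 <= t < n.+1 | n%:R * b < t%:R) x t.

Definition ls_criterion (R : realType) (n m : nat) (x : 'I_m -> nat -> R)
    (b : R) : R :=
  - (n%:R^-1 * \sum_(k < m)
      (\sum_(1 <= t < n.+1 | t%:R <= n%:R * b)
          (x k t - left_mean n (x k) b) ^+ 2
       + \sum_(1 <= t < n.+1 | n%:R * b < t%:R)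
          (x k t - right_mean n (x k) b) ^+ 2)).

(* Ties in the argmax may be broken arbitrarily. *)
Definition is_lse (R : realType) (c : R) (n m : nat) (x : 'I_m -> nat -> R)
    (that : R) : Prop :=
  let candidates := [set b | time_grid n b /\ c < b < 1 - c] in
  candidates that /\
  forall b, candidates b -> ls_criterion n x b <= ls_criterion n x that.

Definition bounded_in_probability d (T : measurableType d) (R : realType)
    (P : probability T R) (Z : nat -> T -> R) : Prop :=
  forall eps : R, 0 < eps -> exists2 C : R, 0 < C &
    \forall n \near \oo, (P [set w | (C < `|Z n w|)%R] <= eps%:E)%E.

(* Main.v *)
Require Import Defs.
From HB Require Import structures.
From mathcomp Require Import all_boot all_order all_algebra.
From mathcomp Require Import finmap.
From mathcomp Require Import all_classical all_reals all_analysis.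
From mathcomp Require Import measurable_realfun.
From mathcomp Require Import ring lra zify.

(** Splitting the sample at time j instead of not at all lowers the residual sum
of squares by the gain of j, so the estimator maximizes the gain summed over the
series (lse_max_gain). Let D be the squared norm of the jump and h the distance
of j from the change point. Without noise the total gain is smaller at j than at the change
point by an amount of order h D. It has to be shown that, outside an event of
small probability, the noise does not make up for this loss at any h with
h D > K, for a large constant K.

Let U_h be the vector, indexed by the series, of the sums of the noise between
the change point and j, let N be the vector of noise bridges at the change point,
and S the vector of complete noise sums. The noise enters the difference of gains
through delta.U_h, N.U_h / n, |U_h|^2 / n and terms which are bounded, up to a
small multiple of h D, by a constant times h / n^2 times |N|^2 + |S|^2
(gain_drop). The last ones are uniform in h, and E|N|^2 + E|S|^2 is
O(m n), which the signal-to-noise condition n D / m -> oo makes negligible. The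
first three need a bound that holds simultaneously for all h, and they are
treated on dyadic ranges of h (level_prob), for which the probabilities can be
added.

The difficulty is the maximum of N.U_h over a dyadic range. As only four moments
of the noise exist, this product has only two, and maximal inequalities based on
second moments lose a logarithm, which the signal-to-noise condition cannot
absorb. Instead, a single series is chained with its fourth moments: the squared
maximum of a path is at most a weighted l^4 norm squared of its dyadic increments
(chain_increment_le), and the mean of this norm, for the path a_k U_kh with a
weight a_k that may be as random as N_k, is of the order of the length of the
range times the size of a_k^2. The l^4 norm is 2-smooth and hence of type 2, so for
independent centered summands such means add up like variances
(sqnorm4_sum_indep). Thus the maximum of sum_k (a_k U_kh - E a_k U_kh) has the
second moment that it would have at a single h, up to a constant
(excursion_lin_prob). For scalars, the same inequality controls the fluctuation
of a sum over the series of bounds for the maxima of U_kh^2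
(excursion_norm_prob).

The fourth moments come from the cumulants: for centered variables, only the
single block and the three pairings contribute to a fourth moment, whence
E (sum of L consecutive terms)^4 = O(L^2) (moment4_sum_le). *)

Import Order.TTheory GRing.Theory Num.Theory.
Import numFieldNormedType.Exports.

Local Open Scope classical_set_scope.
Local Open Scope ring_scope.

Set Implicit Arguments.
Unset Strict Implicit.
Unset Printing Implicit Defensive.

(** * Weighted fourth-power norms and dyadic chaining *)

Lemma norm_double_le_add {R : realType} (A B l : R) :
  0 <= A -> 0 <= B -> l ^+ 2 <= A * B -> `|2 * l| <= A + B.
Proof.
move=> A0 B0 lAB; rewrite -ler_sqr ?nnegrE ?normr_ge0 ?addr_ge0 //.
rewrite -normrX ger0_norm ?sqr_ge0 //.
have := sqr_ge0 (A - B); nra.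
Qed.

Lemma pow4_sub_le {R : realType} (a b : R) :
  (a - b) ^+ 4 <= 8 * (a ^+ 4 + b ^+ 4).
Proof.
have -> : (a - b) ^+ 4 = ((a - b) ^+ 2) ^+ 2 by rewrite -exprM.
have -> : a ^+ 4 = (a ^+ 2) ^+ 2 by rewrite -exprM.
have -> : b ^+ 4 = (b ^+ 2) ^+ 2 by rewrite -exprM.
have h : (a - b) ^+ 2 <= 2 * (a ^+ 2 + b ^+ 2).
  by have := sqr_ge0 (a + b); nra.
have : ((a - b) ^+ 2) ^+ 2 <= (2 * (a ^+ 2 + b ^+ 2)) ^+ 2.
  by rewrite ler_sqr ?nnegrE ?sqr_ge0 // mulr_ge0 // addr_ge0 ?sqr_ge0.
have := sqr_ge0 (a ^+ 2 - b ^+ 2); nra.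
Qed.

Section weighted_ell4.
Context {R : realType} {I : Type} (s : seq I) (w : I -> R).
Hypothesis w_ge0 : forall i, 0 <= w i.
Implicit Types x y : I -> R.

Lemma weighted_cauchy_schwarz x y :
  (\sum_(i <- s) w i * (x i * y i)) ^+ 2 <=
  (\sum_(i <- s) w i * x i ^+ 2) * (\sum_(i <- s) w i * y i ^+ 2).
Proof.
elim: s => [|i s' IH]; first by rewrite !big_nil expr0n mulr0.
rewrite !big_cons.
have A0 : 0 <= \sum_(j <- s') w j * x j ^+ 2.
  by apply: sumr_ge0 => j _; rewrite mulr_ge0 ?sqr_ge0.
have B0 : 0 <= \sum_(j <- s') w j * y j ^+ 2.
  by apply: sumr_ge0 => j _; rewrite mulr_ge0 ?sqr_ge0.
move: IH A0 B0 (w_ge0 i).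
set S := \sum_(j <- s') _ * (_ * _); set A := \sum_(j <- s') w j * x j ^+ 2.
set B := \sum_(j <- s') _; set f := x i; set g := y i; set v := w i.
move=> IH A0 B0 v0.
have cross : 2 * (S * (f * g)) <= A * g ^+ 2 + B * f ^+ 2.
  apply: le_trans (ler_norm _) _.
  rewrite -ler_sqr ?nnegrE ?normr_ge0 //; last first.
    by apply: addr_ge0; apply: mulr_ge0; rewrite ?sqr_ge0.
  rewrite -normrX ger0_norm ?sqr_ge0 //.
  have : S ^+ 2 * (f * g) ^+ 2 <= A * B * (f * g) ^+ 2.
    by rewrite ler_wpM2r ?sqr_ge0.
  have := sqr_ge0 (A * g ^+ 2 - B * f ^+ 2).
  nra.
have := ler_wpM2l v0 cross.
nra.
Qed.

(** The square of the weighted l^4 norm; squaring makes it comparable with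
second moments. *)
Definition sqnorm4 x : R := Num.sqrt (\sum_(i <- s) w i * x i ^+ 4).

Lemma sum4_ge0 x : 0 <= \sum_(i <- s) w i * x i ^+ 4.
Proof.
by apply: sumr_ge0 => i _; rewrite mulr_ge0 // exprn_even_ge0.
Qed.

Lemma sqnorm4_ge0 x : 0 <= sqnorm4 x.
Proof. exact: sqrtr_ge0. Qed.

Lemma sqr_sqnorm4 x : sqnorm4 x ^+ 2 = \sum_(i <- s) w i * x i ^+ 4.
Proof. by rewrite sqr_sqrtr // sum4_ge0. Qed.

Lemma sum22_le x y :
  \sum_(i <- s) w i * (x i ^+ 2 * y i ^+ 2) <= sqnorm4 x * sqnorm4 y.
Proof.
rewrite -ler_sqr ?nnegrE ?mulr_ge0 ?sqnorm4_ge0 //; last first.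
  by apply: sumr_ge0 => i _; rewrite mulr_ge0 // mulr_ge0 ?sqr_ge0.
rewrite exprMn !sqr_sqnorm4.
apply: le_trans (weighted_cauchy_schwarz _ _) _.
by under eq_bigr do rewrite -exprM; under [X in _ * X]eq_bigr do rewrite -exprM.
Qed.

Lemma sum31_le x y :
  (\sum_(i <- s) w i * (x i ^+ 3 * y i)) ^+ 2 <= sqnorm4 x ^+ 3 * sqnorm4 y.
Proof.
have -> : \sum_(i <- s) w i * (x i ^+ 3 * y i) =
          \sum_(i <- s) w i * (x i ^+ 2 * (x i * y i)).
  by apply: eq_bigr => i _; ring.
apply: le_trans (weighted_cauchy_schwarz _ _) _.
have -> : \sum_(i <- s) w i * (x i ^+ 2) ^+ 2 = sqnorm4 x ^+ 2.
  by rewrite sqr_sqnorm4; apply: eq_bigr => i _; rewrite -exprM.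
have -> : \sum_(i <- s) w i * (x i * y i) ^+ 2 =
          \sum_(i <- s) w i * (x i ^+ 2 * y i ^+ 2).
  by apply: eq_bigr => i _; rewrite exprMn.
rewrite (exprSr _ 2) -mulrA; apply: ler_wpM2l (sum22_le x y).
by rewrite sqr_ge0.
Qed.

(** The differential of sqnorm4 at x applied to y; it is 0 when x has norm 0,
since the inverse of 0 is 0. *)
Definition sqnorm4_grad x y : R :=
  2 * (\sum_(i <- s) w i * (x i ^+ 3 * y i)) / sqnorm4 x.

Lemma grad_lin x y : sqnorm4_grad x y =
  \sum_(i <- s) 2 * w i * x i ^+ 3 / sqnorm4 x * y i.
Proof.
rewrite /sqnorm4_grad mulrAC mulr_sumr; apply: eq_bigr => i _.
by ring.
Qed.

(** The inequality of Hoelder for exponents 4 / 3 and 4, with l the quotient of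
the sum of the w x^3 y by sqnorm4 x, so that a vanishing norm is no exception. *)
Lemma grad_sqr_le x y :
  exists2 l, sqnorm4_grad x y = 2 * l &
   \sum_(i <- s) w i * (x i ^+ 3 * y i) = sqnorm4 x * l /\
   l ^+ 2 <= sqnorm4 x * sqnorm4 y.
Proof.
have Ax := sqnorm4_ge0 x; have By := sqnorm4_ge0 y; have := sum31_le x y.
rewrite /sqnorm4_grad; set L := \sum_(i <- s) _; set A := sqnorm4 x.
set B := sqnorm4 y => h31; rewrite -/A -/B in Ax By.
exists (L / A); first by rewrite mulrA.
have [A0|A0] := eqVneq A 0.
  rewrite A0 in h31 *; rewrite invr0 mulr0 mul0r expr0n /=.
  split; last by rewrite mul0r.
  apply/eqP; rewrite -sqrf_eq0 eq_le sqr_ge0 andbT (le_trans h31) //.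
  by rewrite expr0n !mul0r.
split; first by rewrite mulrCA divff // mulr1.
have Apos : 0 < A by rewrite lt_neqAle eq_sym A0.
rewrite -(ler_pM2l (exprn_gt0 2 Apos)) -exprMn mulrCA divff // mulr1.
by apply: le_trans h31 _; rewrite mulrA -exprSr.
Qed.

(** A convex function lies above its tangent. Taking means in y gives Jensen's
inequality for sqnorm4. *)
Lemma sqnorm4_convex x y :
  sqnorm4 x + sqnorm4_grad x (fun i => y i - x i) <= sqnorm4 y.
Proof.
have Ax := sqnorm4_ge0 x; have By := sqnorm4_ge0 y.
have [l Hl [HL l2]] := grad_sqr_le x y.
have -> : sqnorm4_grad x (fun i => y i - x i) =
          sqnorm4_grad x y - sqnorm4_grad x x.
  by rewrite !grad_lin -sumrB; apply: eq_bigr => i _; rewrite mulrBr.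
have -> : sqnorm4_grad x x = 2 * sqnorm4 x.
  rewrite /sqnorm4_grad.
  have -> : \sum_(i <- s) w i * (x i ^+ 3 * x i) = sqnorm4 x ^+ 2.
    by rewrite sqr_sqnorm4; apply: eq_bigr => i _; rewrite -exprSr.
  have [->|A0] := eqVneq (sqnorm4 x) 0; first by rewrite invr0 !mulr0.
  by rewrite expr2 mulrA mulfK.
have := norm_double_le_add Ax By l2; rewrite Hl ler_norml => /andP[_].
lra.
Qed.

(** The l^4 norm is 2-uniformly smooth: the remainder of the first order
expansion of its square is itself quadratic. This replaces the identity for
|x + y|^2 of a Hilbert space when independent centered vectors are added. *)
Lemma sqnorm4_smooth x y :
  sqnorm4 (fun i => x i + y i) <=
  sqnorm4 x + sqnorm4_grad x y + 7 * sqnorm4 y.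
Proof.
have Ax := sqnorm4_ge0 x; have By := sqnorm4_ge0 y.
have [l Hl [HL l2]] := grad_sqr_le x y.
have [l' Hl' [HL' l2']] := grad_sqr_le y x.
have E : sqnorm4 (fun i => x i + y i) ^+ 2 = sqnorm4 x ^+ 2 +
   4 * \sum_(i <- s) w i * (x i ^+ 3 * y i) +
   6 * \sum_(i <- s) w i * (x i ^+ 2 * y i ^+ 2) +
   4 * \sum_(i <- s) w i * (y i ^+ 3 * x i) + sqnorm4 y ^+ 2.
  rewrite !sqr_sqnorm4 !mulr_sumr -!big_split /=; apply: eq_bigr => i _.
  by ring.
have h22 := sum22_le x y.
have base : 0 <= sqnorm4 x + 2 * l + 7 * sqnorm4 y.
  have := norm_double_le_add Ax By l2; rewrite ler_norml => /andP[].
  lra.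
rewrite Hl -ler_sqr ?nnegrE ?sqnorm4_ge0 // E HL HL'.
move: h22 l2 l2' base Ax By.
set A := sqnorm4 x; set B := sqnorm4 y.
set M := \sum_(i <- s) _ => h22 l2 l2' base Ax By.
have l'B : 2 * l' <= A + B.
  have := norm_double_le_add Ax By; move/(_ l'); rewrite ler_norml [A * B]mulrC.
  by move=> /(_ l2') /andP[].
have l'B2 : 4 * (B * l') <= 2 * (A * B) + 2 * B ^+ 2.
  by have := ler_wpM2l By l'B; nra.
have [lB|lB] := leP (2 * B) `|2 * l + 7 * B|.
  have : (2 * B) ^+ 2 <= (2 * l + 7 * B) ^+ 2.
    rewrite -[leRHS]real_normK ?num_real// ler_sqr ?nnegrE ?normr_ge0//.
    by lra.
  nra.
have lneg : 5 * B <= - (2 * l) by move: lB; rewrite ltr_norml => /andP[]; lra.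
have : (5 * B) ^+ 2 <= (2 * l) ^+ 2.
  by rewrite -[leRHS]sqrrN ler_sqr ?nnegrE //; lra.
have := sqr_ge0 (2 * l + 7 * B).
move=> h0 h1.
have h25 : 25 * B ^+ 2 <= 4 * (A * B) by nra.
nra.
Qed.

Lemma sqnorm4_sub_le x y :
  sqnorm4 (fun i => x i - y i) <= 3 * (sqnorm4 x + sqnorm4 y).
Proof.
have Ax := sqnorm4_ge0 x; have By := sqnorm4_ge0 y.
rewrite -ler_sqr ?nnegrE ?sqnorm4_ge0 //; last by lra.
rewrite exprMn.
have : sqnorm4 (fun i => x i - y i) ^+ 2 <=
       8 * (sqnorm4 x ^+ 2 + sqnorm4 y ^+ 2).
  rewrite !sqr_sqnorm4 -big_split mulr_sumr; apply: ler_sum => i _ /=.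
  rewrite -mulrDr [leRHS]mulrCA; apply: ler_wpM2l => //.
  exact: pow4_sub_le.
by nra.
Qed.

Lemma sqnorm4_scale a x :
  sqnorm4 (fun i => a * x i) = a ^+ 2 * sqnorm4 x.
Proof.
rewrite /sqnorm4.
have -> : \sum_(i <- s) w i * (a * x i) ^+ 4 =
          (a ^+ 2) ^+ 2 * \sum_(i <- s) w i * x i ^+ 4.
  by rewrite mulr_sumr; apply: eq_bigr => i _; ring.
by rewrite sqrtrM ?sqr_ge0 // sqrtr_sqr ger0_norm ?sqr_ge0.
Qed.

End weighted_ell4.

(** Convexity of the fourth power, with a coefficient of a^4 below 2: two
half-length sums then cost less than the factor 4 gained by doubling the
length. *)
Lemma pow4_add_le {R : realType} (a b : R) :
  (a + b) ^+ 4 <= 3 / 2 * a ^+ 4 + 1000 * b ^+ 4.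
Proof.
have -> : (a + b) ^+ 4 = ((a + b) ^+ 2) ^+ 2 by rewrite -exprM.
have -> : a ^+ 4 = (a ^+ 2) ^+ 2 by rewrite -exprM.
have -> : b ^+ 4 = (b ^+ 2) ^+ 2 by rewrite -exprM.
have h : (a + b) ^+ 2 <= 10 / 9 * a ^+ 2 + 10 * b ^+ 2.
  by have := sqr_ge0 (a - 9 * b); nra.
have : ((a + b) ^+ 2) ^+ 2 <= (10 / 9 * a ^+ 2 + 10 * b ^+ 2) ^+ 2.
  by rewrite ler_sqr ?nnegrE ?sqr_ge0 // addr_ge0 // mulr_ge0 ?sqr_ge0.
have := sqr_ge0 (a ^+ 2 - 50 * b ^+ 2); nra.
Qed.

(** Bisection of [a, a + 2^r]: each triple is a depth and the two ends of an
interval whose increment is used to reach a point of [a, a + 2^r]. *)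
Fixpoint chain (r a : nat) : seq (nat * nat * nat) :=
  if r is r'.+1 then
    (0%N, a, a + 2 ^ r')%N ::
    [seq (i.1.1.+1, i.1.2, i.2) | i <- chain r' a ++ chain r' (a + 2 ^ r')]
  else [:: (0%N, a, a.+1)].

Definition chain_weight {R : realType} (i : nat * nat * nat) : R :=
  1000 * (3 / 2) ^+ i.1.1.

Lemma chain_weight_ge0 {R : realType} i : 0 <= chain_weight i :> R.
Proof.
have h : 0 <= 3 / 2 :> R by lra.
exact: mulr_ge0 (ler0n R 1000) (exprn_ge0 _ h).
Qed.

Lemma chain_weight_sumS {R : realType} (s : seq (nat * nat * nat))
    (F : nat * nat * nat -> R) :
  \sum_(i <- s) chain_weight (i.1.1.+1, i.1.2, i.2) * F i =
  3 / 2 * \sum_(i <- s) chain_weight i * F i.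
Proof.
rewrite mulr_sumr; apply: eq_bigr => i _.
by rewrite /chain_weight /= exprS; ring.
Qed.

(** Bisection bound for the maximum of a path. Its right-hand side is a fixed
combination of fourth powers of increments, so no maximum has to be measured or
integrated. *)
Lemma chain_increment_le {R : realType} (S : nat -> R) r a h :
  (h <= 2 ^ r)%N ->
  (S (a + h)%N - S a) ^+ 4 <=
  \sum_(i <- chain r a) chain_weight i * (S i.2 - S i.1.2) ^+ 4.
Proof.
have pow4 (x : R) : 0 <= x ^+ 4 by rewrite exprn_even_ge0.
elim: r a h => [|r IH] a h.
  rewrite expn0 big_seq1 /chain_weight /= expr0 mulr1.
  case: h => [|[|//]] _; last by rewrite addn1; have := pow4 (S a.+1 - S a); lra.
  rewrite addn0 subrr expr0n /=; exact: mulr_ge0 (ler0n R 1000) (pow4 _).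
move=> hr; rewrite /= big_cons big_map big_cat /=.
rewrite !(chain_weight_sumS _ (fun i => (S i.2 - S i.1.2) ^+ 4)).
have sum0 b : 0 <= \sum_(i <- chain r b) chain_weight i * (S i.2 - S i.1.2) ^+ 4.
  by apply: sumr_ge0 => i _; rewrite mulr_ge0 // chain_weight_ge0.
have := sum0 a; have := sum0 (a + 2 ^ r)%N.
have := pow4 (S (a + 2 ^ r)%N - S a).
have [h_le|h_gt] := leqP h (2 ^ r).
  have := IH a h h_le; rewrite /chain_weight /= expr0; lra.
have h'le : (h - 2 ^ r <= 2 ^ r)%N by rewrite leq_subLR addnn -mul2n -expnS.
have := IH (a + 2 ^ r)%N _ h'le; rewrite -addnA subnKC ?(ltnW h_gt) //.
have := pow4_add_le (S (a + h)%N - S (a + 2 ^ r)%N) (S (a + 2 ^ r)%N - S a).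
by rewrite subrKA /chain_weight /= expr0; lra.
Qed.

(** An increment over a length l of a weakly dependent sum has fourth moment of
order l^2; the weights keep the total of order 4^r, without the power of r that
second moments would cost. *)
Lemma chain_weighted_lengths {R : realType} r a :
  \sum_(i <- chain r a) chain_weight i * (i.2%:R - i.1.2%:R) ^+ 2 <=
  1000 * 4 ^+ r :> R.
Proof.
elim: r a => [|r IH] a.
  rewrite big_seq1 /chain_weight /= -natrB // subSnn; lra.
rewrite /= big_cons big_map big_cat /=.
rewrite !(chain_weight_sumS _ (fun i => (i.2%:R - i.1.2%:R) ^+ 2)).
have -> : ((a + 2 ^ r)%:R - a%:R) ^+ 2 = 4 ^+ r :> R.
  by rewrite natrD addrAC subrr add0r natrX -exprM mulnC exprM -natrX.
by have := IH a; have := IH (a + 2 ^ r)%N; rewrite /chain_weight /= exprS expr0; lra.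
Qed.

(** * The least squares criterion as a gain *)

Section criterion.
Context {R : realType}.
Implicit Types x y : nat -> R.

Definition psum x (j : nat) : R := \sum_(1 <= t < j.+1) x t.

Lemma psumB x (i j : nat) : (i <= j)%N ->
  psum x j - psum x i = \sum_(i.+1 <= t < j.+1) x t.
Proof.
by move=> ij; rewrite /psum (@big_cat_nat _ _ _ i.+1) //= addrAC subrr add0r.
Qed.

(** The between-segment sum of squares for a split after time j. *)
Definition gain (n : nat) x (j : nat) : R :=
  (j%:R^-1 + (n - j)%:R^-1) * (psum x j - j%:R / n%:R * psum x n) ^+ 2.

Lemma sum_left (n j : nat) (F : nat -> R) : (0 < n)%N -> (j <= n)%N ->
  \sum_(1 <= t < n.+1 | t%:R <= n%:R * (j%:R / n%:R) :> R) F t = psum F j.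
Proof.
move=> n0 jn; rewrite /psum [RHS](big_nat_widen _ _ n.+1) //=; apply: eq_bigl => t.
by rewrite mulrC divfK ?pnatr_eq0 -?lt0n // ler_nat ltnS.
Qed.

Lemma sum_right (n j : nat) (F : nat -> R) : (0 < n)%N -> (j <= n)%N ->
  \sum_(1 <= t < n.+1 | n%:R * (j%:R / n%:R) < t%:R :> R) F t =
  psum F n - psum F j.
Proof.
move=> n0 jn; apply/eqP; rewrite eq_sym subr_eq addrC -(sum_left F n0 jn).
rewrite /psum (bigID (fun t : nat => t%:R <= n%:R * (j%:R / n%:R) :> R)) /=.
by apply/eqP; congr (_ + _); apply: eq_bigl => t; rewrite -real_ltNge ?num_real.
Qed.

Lemma psum_sqr_sub x j (c : R) :
  psum (fun t => (x t - c) ^+ 2) j =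
  psum (fun t => x t ^+ 2) j - 2 * c * psum x j + c ^+ 2 * j%:R.
Proof.
rewrite /psum; under eq_bigr do rewrite sqrrB.
rewrite big_split sumrB /= sumr_const_nat subSS subn0 mulr_natr.
congr (_ - _ + _); rewrite mulr_sumr; apply: eq_bigr => t _.
by ring.
Qed.

(** The least squares criterion at a split point is, up to a quantity which
does not depend on the split point, the average of the between-segment sums
of squares. *)
Lemma ls_criterionE (n m j : nat) (x : 'I_m -> nat -> R) :
  (0 < j < n)%N ->
  ls_criterion n x (j%:R / n%:R) =
  - (n%:R^-1 * \sum_(k < m) (psum (fun t => x k t ^+ 2) n
                             - psum (x k) n ^+ 2 / n%:R))
  + n%:R^-1 * \sum_(k < m) gain n (x k) j.
Proof.
move=> /andP[j0 jn].
have n0 : (0 < n)%N by exact: leq_trans jn.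
have njn : (j <= n)%N by exact: ltnW.
have nr : n%:R != 0 :> R by rewrite pnatr_eq0 -lt0n.
have jr : j%:R != 0 :> R by rewrite pnatr_eq0 -lt0n.
have njr : (n - j)%:R != 0 :> R by rewrite pnatr_eq0 -lt0n subn_gt0.
have njE : n%:R = j%:R + (n - j)%:R :> R by rewrite -natrD subnKC.
rewrite /ls_criterion addrC -mulrBr -mulrN; congr (_ * _).
rewrite -sumrB -sumrN; apply: eq_bigr => k _.
rewrite sum_left // sum_right // /left_mean /right_mean sum_left // sum_right //.
rewrite !psum_sqr_sub /gain.
have -> : n%:R * (j%:R / n%:R) = j%:R :> R by rewrite mulrC divfK.
have -> : n%:R * (1 - j%:R / n%:R) = (n - j)%:R :> R.
  by rewrite mulrBr mulr1 mulrC divfK // natrB.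
move: (psum _ n) (psum _ j) (psum (x k) n) (psum (x k) j) => Q Qj S Sj.
rewrite njE; rewrite njE in nr; move: jr njr nr.
move: j%:R (n - j)%:R => a b ha hb hab.
by field; rewrite hab hb ha.
Qed.

Lemma lse_max_gain (c : R) (n m : nat) (x : 'I_m -> nat -> R) (that : R)
    (j0 : nat) :
  0 < c -> is_lse c n x that ->
  (0 < j0 <= n)%N -> c < j0%:R / n%:R < 1 - c ->
  exists j, [/\ (0 < j < n)%N, that = j%:R / n%:R,
     c < j%:R / n%:R < 1 - c &
     \sum_(k < m) gain n (x k) j0 <= \sum_(k < m) gain n (x k) j].
Proof.
move=> c0 [[[j jn ->] jc] hmax] j0n j0c.
have lt_n i : (0 < i <= n)%N -> c < i%:R / n%:R < 1 - c -> (0 < i < n)%N.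
  move=> /andP[i0]; rewrite leq_eqVlt => /orP[/eqP -> | -> _]; last by rewrite i0.
  case: n {jn jc hmax j0n j0c} => [|n]; first by rewrite invr0 mulr0; lra.
  by rewrite divff ?pnatr_eq0 //; lra.
have jn' := lt_n _ jn jc; have j0n' := lt_n _ j0n j0c.
exists j; split => //.
have := hmax (j0%:R / n%:R); rewrite !ls_criterionE // lerD2l.
have n0 : 0 < n%:R^-1 :> R.
  by rewrite invr_gt0 ltr0n; move: jn => /andP[/leq_trans]; apply.
rewrite ler_pM2l //; apply; split => //.
by exists j0.
Qed.

End criterion.

(** Everything that happens for a single realization: if the noise terms are
below the levels given by theta, then a split point at distance h from the
change point has a smaller gain. Here a and a0 are the weights of the gain,
s and s0 the coefficients of the jump delta at the two split points, and g is
the signed value of h / n. The power of c in theta beats the negative powers of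
c that come from the weights near the ends of the range. *)
Lemma gain_drop {R : realType} (m : nat) (delta N0 U Sn : 'I_m -> R)
    (n h c theta rho a a0 s s0 g : R) :
  let D := \sum_k delta k ^+ 2 in
  0 < n -> 0 < h <= n -> 0 < D -> 0 < c <= 1 -> theta = c ^+ 3 / 32 ->
  a * s = rho -> a0 * s0 = 1 -> a0 * s0 ^+ 2 - a * s ^+ 2 = h * rho ->
  c <= rho <= 1 -> 1 - rho <= h / (c * n) ->
  0 <= a <= 2 / (c * n) -> `|a - a0| <= 2 * h / (c * n) ^+ 2 ->
  `|g| = h / n ->
  \sum_k (N0 k ^+ 2 + Sn k ^+ 2) <= theta ^+ 2 * n ^+ 2 * D ->
  \sum_k U k ^+ 2 <= theta * n * (h * D) ->
  `|\sum_k delta k * U k| <= theta * (h * D) ->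
  `|\sum_k N0 k * U k| <= theta * n * (h * D) ->
  \sum_k a * (s * delta k + (N0 k + U k - g * Sn k)) ^+ 2 <
  \sum_k a0 * (s0 * delta k + N0 k) ^+ 2.
Proof.
move=> D n0 /andP[h0 hn] D0 /andP[c0 c1] thE as_ as0 drop /andP[rc r1] rho1.
move=> /andP[a_ge0 a_le] aa0 gE.
rewrite big_split /=.
have th0 : 0 < theta by rewrite thE divr_gt0 // exprn_gt0.
set p := \sum_k N0 k ^+ 2; set q := \sum_k Sn k ^+ 2; set u := \sum_k U k ^+ 2.
set dU := \sum_k delta k * U k; set NU := \sum_k N0 k * U k.
move=> hF hu hdU hNU.
have p0 : 0 <= p by apply: sumr_ge0 => k _; exact: sqr_ge0.
have q0 : 0 <= q by apply: sumr_ge0 => k _; exact: sqr_ge0.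
have u0 : 0 <= u by apply: sumr_ge0 => k _; exact: sqr_ge0.
set dN := \sum_k delta k * N0 k; set dS := \sum_k delta k * Sn k.
set NS := \sum_k N0 k * Sn k; set US := \sum_k U k * Sn k.
have young (v w : 'I_m -> R) (l : R) : 0 < l ->
    `|\sum_k v k * w k| <=
    l / 2 * (\sum_k v k ^+ 2) + (2 * l)^-1 * (\sum_k w k ^+ 2).
  move=> l0; apply: le_trans (ler_norm_sum _ _ _) _.
  rewrite !mulr_sumr -big_split; apply: ler_sum => k _ /=.
  rewrite normrM -(real_normK (num_real (v k))) -(real_normK (num_real (w k))).
  have l2 : 0 < 2 * l by rewrite mulr_gt0.
  rewrite -(ler_pM2l l2) mulrDr [X in _ + X]mulrA divff ?gt_eqF // mul1r.
  have := sqr_ge0 (l * `|v k| - `|w k|); nra.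
have thn : 0 < theta * n by rewrite mulr_gt0.
have static (w : 'I_m -> R) : \sum_k w k ^+ 2 <= theta ^+ 2 * n ^+ 2 * D ->
    `|\sum_k delta k * w k| <= theta * n * D.
  move=> hw; apply: le_trans (young delta w _ thn) _.
  have : (2 * (theta * n))^-1 * (\sum_k w k ^+ 2) <= theta * n / 2 * D.
    rewrite ler_pdivrMl ?mulr_gt0 //; apply: le_trans hw _; nra.
  rewrite -/D; lra.
have hdN : `|dN| <= theta * n * D by apply: static; rewrite -/p; lra.
have hdS : `|dS| <= theta * n * D by apply: static; rewrite -/q; lra.
have hNS : `|NS| <= (p + q) / 2.
  by have := young N0 Sn 1 ltr01; rewrite -/NS -/p -/q mulr1; lra.
have hUS : `|g * US| <= (u + g ^+ 2 * q) / 2.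
  have -> : g * US = \sum_k U k * (g * Sn k).
    by rewrite mulr_sumr; apply: eq_bigr => k _; ring.
  have -> : g ^+ 2 * q = \sum_k (g * Sn k) ^+ 2.
    by rewrite mulr_sumr; apply: eq_bigr => k _; rewrite exprMn.
  by have := young U (fun k => g * Sn k) 1 ltr01; rewrite -/u mulr1; lra.
have gq : g ^+ 2 * q <= h / n * q.
  apply: ler_wpM2r => //; rewrite -(real_normK (num_real g)) gE expr2.
  have h0n : 0 <= h / n by rewrite divr_ge0 ?ltW.
  by rewrite -[leRHS]mulr1 ler_wpM2l // ler_pdivrMr // mul1r.
have -> : \sum_k a * (s * delta k + (N0 k + U k - g * Sn k)) ^+ 2 =
  a * s ^+ 2 * D + 2 * rho * (dN + dU - g * dS)
  + a * (p + u + g ^+ 2 * q + 2 * NU - 2 * (g * NS) - 2 * (g * US)).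
  rewrite -as_ !mulrDr !mulrN !mulr_sumr -!sumrN -!big_split /=.
  by apply: eq_bigr => k _; ring.
have -> : \sum_k a0 * (s0 * delta k + N0 k) ^+ 2 =
  a0 * s0 ^+ 2 * D + 2 * dN + a0 * p.
  have -> : 2 * dN = 2 * (a0 * s0) * dN by rewrite as0 mulr1.
  by rewrite !mulr_sumr -!big_split /=; apply: eq_bigr => k _; ring.
clear young static; clearbody p q u dU NU dN dS NS US D; clear delta N0 U Sn m.
set H := h * D in hu hdU hNU *.
have H0 : 0 < H by rewrite mulr_gt0.
have cn : 0 < c * n by rewrite mulr_gt0.
have small : 2 * theta / c + 4 * theta + 2 * theta ^+ 2 / c ^+ 2
    + 2 / c * (4 * theta + 3 * theta ^+ 2) < c.
  have -> : 2 * theta / c + 4 * theta + 2 * theta ^+ 2 / c ^+ 2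
    + 2 / c * (4 * theta + 3 * theta ^+ 2) =
    c * (10 / 32 * c + 4 / 32 * c ^+ 2 + 2 / 1024 * c ^+ 3 + 6 / 1024 * c ^+ 4).
    by rewrite thE; field; rewrite gt_eqF.
  rewrite -[ltRHS]mulr1 (ltr_pM2l c0).
  have cX k : c ^+ k <= 1 by rewrite exprn_ile1 // ltW.
  by move: (cX 2%N) (cX 3%N) (cX 4%N) c1; clear; lra.
clear thE as_ as0.
(* each error is at most a multiple of theta h D, the loss at least c h D *)
have e1 : 2 * (rho - 1) * dN <= 2 * theta / c * H.
  have : `|(1 - rho) * dN| <= theta / c * H.
    rewrite normrM (ger0_norm (x := 1 - rho)); last by lra.
    have -> : theta / c * H = h / (c * n) * (theta * n * D).
      by rewrite /H; field; rewrite !gt_eqF.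
    by apply: ler_pM => //; lra.
  by rewrite ler_norml => /andP[]; clear; lra.
have e2 : 2 * rho * dU <= 2 * theta * H.
  have : `|rho * dU| <= theta * H.
    rewrite normrM -[leRHS]mul1r; apply: ler_pM => //.
    by rewrite ger0_norm //; lra.
  by rewrite ler_norml => /andP[]; clear; lra.
have e3 : - (2 * rho * (g * dS)) <= 2 * theta * H.
  have : `|rho * (g * dS)| <= theta * H.
    rewrite !normrM -[leRHS]mul1r; apply: ler_pM => //.
      by rewrite ger0_norm //; lra.
    have -> : theta * H = h / n * (theta * n * D).
      by rewrite /H; field; rewrite gt_eqF.
    by rewrite gE; apply: ler_pM => //; rewrite divr_ge0 // ltW.
  by rewrite ler_norml => /andP[]; clear; lra.
have e4 : (a - a0) * p <= 2 * theta ^+ 2 / c ^+ 2 * H.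
  apply: le_trans (ler_norm _) _; rewrite normrM (ger0_norm p0).
  have -> : 2 * theta ^+ 2 / c ^+ 2 * H =
     2 * h / (c * n) ^+ 2 * (theta ^+ 2 * n ^+ 2 * D).
    by rewrite /H; field; rewrite !gt_eqF.
  by apply: ler_pM => //; lra.
have hnF : h / n * (p + q) <= theta ^+ 2 * n * H.
  have -> : theta ^+ 2 * n * H = h / n * (theta ^+ 2 * n ^+ 2 * D).
    by rewrite /H; field; rewrite gt_eqF.
  by apply: ler_wpM2l => //; rewrite divr_ge0 // ltW.
have gNS : - (g * NS) <= h / n * (p + q) / 2.
  rewrite -mulrA; have : `|g * NS| <= h / n * ((p + q) / 2).
    by rewrite normrM gE; apply: ler_wpM2l => //; rewrite divr_ge0 // ltW.
  by rewrite ler_norml => /andP[h1 _]; move: h1; clear; lra.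
have hnq : h / n * q <= h / n * (p + q).
  by apply: ler_wpM2l; [rewrite divr_ge0 // ltW|lra].
have e5 : a * (u + g ^+ 2 * q + 2 * NU - 2 * (g * NS) - 2 * (g * US))
    <= 2 / c * (4 * theta + 3 * theta ^+ 2) * H.
  have -> : 2 / c * (4 * theta + 3 * theta ^+ 2) * H =
     2 / (c * n) * (4 * (theta * n * H) + 3 * (theta ^+ 2 * n * H)).
    by field; rewrite !gt_eqF.
  have inner : u + g ^+ 2 * q + 2 * NU - 2 * (g * NS) - 2 * (g * US) <=
     4 * (theta * n * H) + 3 * (theta ^+ 2 * n * H).
    by move: hNU hUS; rewrite !ler_norml => /andP[_ ?] /andP[? _]; lra.
  have big0 : 0 <= 4 * (theta * n * H) + 3 * (theta ^+ 2 * n * H).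
    by rewrite addr_ge0 // !mulr_ge0 ?sqr_ge0 // ltW.
  apply: le_trans (ler_wpM2l a_ge0 inner) _.
  exact: ler_wpM2r.
have rH : c * H <= rho * H by rewrite ler_wpM2r // ltW.
have smallH := ltr_pM2r H0 _ c; rewrite -smallH in small.
have dropE : a * s ^+ 2 * D - a0 * s0 ^+ 2 * D = - (rho * H).
  by rewrite -mulrBl -opprB drop /H; ring.
move: small e1 e2 e3 e4 e5 rH dropE; rewrite !mulrDl; clear; lra.
Qed.

(** * Means and outer probabilities *)

Section mean_bounds.
Context d (T : measurableType d) (R : realType) (P : probability T R).
Implicit Types (f g : T -> R) (b : R).

(** Stating bounds on means in this form avoids separate integrability hypotheses. *)
Definition mean_le f b :=
  [/\ measurable_fun setT f, forall w, 0 <= f w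
    & (\int[P]_w (f w)%:E <= b%:E)%E].

Definition integ f := P.-integrable setT (EFin \o f).

Lemma integ_measurable f : integ f -> measurable_fun setT f.
Proof. by move=> /integrableP[/measurable_EFinP]. Qed.

Lemma mean_le_integ f b : mean_le f b -> integ f.
Proof.
move=> [mf f0 fb]; apply/integrableP; split; first exact/measurable_EFinP.
under eq_integral do rewrite /= ger0_norm //.
by apply: le_lt_trans fb _; rewrite ltry.
Qed.

Lemma EFin_mean f : integ f -> ((\int[P]_w f w)%R%:E = \int[P]_w (f w)%:E)%E.
Proof. by move=> h; rewrite /Rintegral fineK //; exact: integrable_fin_num. Qed.

Lemma mean_leP f b : integ f -> (forall w, 0 <= f w) ->
  \int[P]_w f w <= b -> mean_le f b.
Proof.
move=> fi f0 fb; split => //; first exact: integ_measurable.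
by rewrite -EFin_mean // lee_fin.
Qed.

Lemma mean_le_mean f b : mean_le f b -> \int[P]_w f w <= b.
Proof.
by move=> h; rewrite -lee_fin EFin_mean ?(mean_le_integ h) //; case: h.
Qed.

Lemma mean_le_ge0 f b : mean_le f b -> 0 <= b.
Proof.
move=> [_ f0 fb]; rewrite -lee_fin; apply: le_trans fb.
by apply: integral_ge0 => w _; rewrite lee_fin.
Qed.

Lemma integ_cst b : integ (fun=> b).
Proof. exact: finite_measure_integrable_cst. Qed.

Lemma integD f g : integ f -> integ g -> integ (fun w => f w + g w).
Proof.
move=> fi gi; have := integrableD measurableT fi gi.
by apply: eq_integrable.
Qed.

Lemma integZ b f : integ f -> integ (fun w => b * f w).
Proof.
move=> fi; have := integrableZl measurableT b fi.
by apply: eq_integrable.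
Qed.

Lemma integB f g : integ f -> integ g -> integ (fun w => f w - g w).
Proof.
move=> fi gi; have := integD fi (integZ (-1) gi).
by apply: eq_integrable => // w _; rewrite /= mulN1r.
Qed.

Lemma integ_sum I (s : seq I) (F : I -> T -> R) :
  (forall i, integ (F i)) -> integ (fun w => \sum_(i <- s) F i w).
Proof.
move=> h; elim: s => [|i s IH].
  by apply: eq_integrable (integ_cst 0) => // w _; rewrite /= big_nil.
by apply: eq_integrable (integD (h i) IH) => // w _; rewrite /= big_cons.
Qed.

Lemma mean_sum I (s : seq I) (F : I -> T -> R) :
  (forall i, integ (F i)) ->
  \int[P]_w (\sum_(i <- s) F i w) = \sum_(i <- s) \int[P]_w F i w.
Proof.
move=> h; elim: s => [|i s IH].
  rewrite big_nil; under eq_Rintegral do rewrite big_nil.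
  by rewrite Rintegral_cst // mul0r.
rewrite big_cons -IH -RintegralD //; [|exact: h|exact: integ_sum].
by apply: eq_Rintegral => w _; rewrite big_cons.
Qed.

Lemma mean_cst b : \int[P]_w (cst b w) = b.
Proof.
by rewrite Rintegral_cst //= probability_setT mulr1.
Qed.

Lemma integ_le f g : measurable_fun setT f -> integ g ->
  (forall w, `|f w| <= g w) -> integ f.
Proof.
move=> mf gi fg; apply: (le_integrable measurableT _ _ gi).
  exact/measurable_EFinP.
by move=> w _; rewrite /= lee_fin (le_trans (fg w)) // ler_norm.
Qed.

Lemma mean_le_le f g b : measurable_fun setT f -> (forall w, 0 <= f w <= g w) ->
  mean_le g b -> mean_le f b.
Proof.
move=> mf fg [mg g0 gb]; split => //; first by move=> w; case/andP: (fg w).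
apply: le_trans gb; apply: ge0_le_integral => //.
- by move=> w _; rewrite lee_fin; case/andP: (fg w).
- exact/measurable_EFinP.
- exact/measurable_EFinP.
- by move=> w _; rewrite lee_fin; case/andP: (fg w).
Qed.

Lemma mean_leW f b b' : b <= b' -> mean_le f b -> mean_le f b'.
Proof.
by move=> bb [mf f0 fb]; split => //; apply: le_trans fb _; rewrite lee_fin.
Qed.

Lemma mean_leD f g b b' : mean_le f b -> mean_le g b' ->
  mean_le (fun w => f w + g w) (b + b').
Proof.
move=> [mf f0 fb] [mg g0 gb]; split.
- exact: measurable_funD.
- by move=> w; rewrite addr_ge0.
under eq_integral do rewrite EFinD.
rewrite ge0_integralD //; first by rewrite EFinD leeD.
- by move=> w _; rewrite lee_fin.
- exact/measurable_EFinP.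
- by move=> w _; rewrite lee_fin.
- exact/measurable_EFinP.
Qed.

Lemma mean_leZ a f b : 0 <= a -> mean_le f b ->
  mean_le (fun w => a * f w) (a * b).
Proof.
move=> a0 [mf f0 fb]; split.
- exact: measurable_funM.
- by move=> w; rewrite mulr_ge0.
under eq_integral do rewrite EFinM.
rewrite ge0_integralZl_EFin //; first by rewrite EFinM lee_wpmul2l // lee_fin.
- by move=> w _; rewrite lee_fin.
- exact/measurable_EFinP.
Qed.

Lemma mean_le0 : mean_le (fun=> 0) 0.
Proof. by split => //; rewrite integral0. Qed.

Lemma mean_le_sum I (s : seq I) (F : I -> T -> R) (b : I -> R) :
  (forall i, mean_le (F i) (b i)) ->
  mean_le (fun w => \sum_(i <- s) F i w) (\sum_(i <- s) b i).
Proof.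
move=> h; elim: s => [|i s IH].
  by rewrite big_nil; under eq_fun do rewrite big_nil; exact: mean_le0.
by rewrite big_cons; under eq_fun do rewrite big_cons; exact: mean_leD.
Qed.

(** Outer probability at most p; the events below come from unions over
split points whose measurability is of no interest. *)
Definition prob_le (A : set T) (p : R) :=
  exists B, [/\ measurable B, A `<=` B & (P B <= p%:E)%E].

Lemma prob_leS A A' p : A `<=` A' -> prob_le A' p -> prob_le A p.
Proof. by move=> AA [B [mB AB Bp]]; exists B; split => // w /AA /AB. Qed.

Lemma prob_leW A p p' : p <= p' -> prob_le A p -> prob_le A p'.
Proof.
move=> pp [B [mB AB Bp]]; exists B; split => //.
by apply: le_trans Bp _; rewrite lee_fin.
Qed.

Lemma prob_leU A A' p p' : prob_le A p -> prob_le A' p' ->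
  prob_le (A `|` A') (p + p').
Proof.
move=> [B [mB AB Bp]] [B' [mB' AB' Bp']]; exists (B `|` B'); split.
- exact: measurableU.
- exact: setUSS.
by apply: le_trans (measureU2 P mB mB') _; rewrite EFinD leeD.
Qed.

Lemma prob_le0 : prob_le set0 0.
Proof. by exists set0; split => //; rewrite measure0. Qed.

Lemma prob_le_bigU (s : seq nat) (A : nat -> set T) (p : nat -> R) :
  (forall i, i \in s -> prob_le (A i) (p i)) ->
  prob_le [set w | exists2 i, i \in s & A i w] (\sum_(i <- s) p i).
Proof.
elim: s => [|i s IH] h.
  by rewrite big_nil; apply: prob_leS prob_le0 => w [].
rewrite big_cons; apply: (@prob_leS _ (A i `|` [set w | exists2 j, j \in s & A j w])).
  by move=> w [j]; rewrite inE => /predU1P[-> ?|? ?]; [left|right; exists j].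
apply: prob_leU; first by apply: h; rewrite inE eqxx.
by apply: IH => j js; apply: h; rewrite inE js orbT.
Qed.

Lemma prob_le_measurable A p : measurable A -> prob_le A p -> (P A <= p%:E)%E.
Proof.
move=> mA [B [mB AB Bp]]; apply: le_trans Bp; apply: le_measure => //.
all: by rewrite inE.
Qed.

Lemma prob_le_markov f b x : 0 < x -> mean_le f b ->
  prob_le [set w | x < f w] (b / x).
Proof.
move=> x0 [mf f0 fb].
have mA : measurable [set w | x <= f w].
  rewrite (_ : [set w | _] = setT `&` f @^-1` `[x, +oo[).
    by apply: mf => //; exact: measurable_itv.
  by rewrite setTI; apply/seteqP; split => w /=; rewrite in_itv /= andbT.
exists [set w | x <= f w]; split => //; first by move=> w /=; exact: ltW.
rewrite EFinM lee_pdivlMr // muleC.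
apply: le_trans fb.
have -> : (x%:E * P [set w | (x <= f w)%R] =
  \int[P]_w (x%:E * (\1_[set w | (x <= f w)%R] w)%:E))%E.
  rewrite ge0_integralZl_EFin //; first by rewrite integral_indic // setIT.
  - exact/measurable_EFinP.
  - exact: ltW.
apply: ge0_le_integral => //.
- by move=> w _; rewrite mule_ge0 // lee_fin ltW.
- by apply: measurable_funeM; exact/measurable_EFinP.
- exact/measurable_EFinP.
move=> w _; rewrite indicE; case: (boolP (w \in _)).
  by rewrite inE /= mule1 lee_fin.
by rewrite mule0 lee_fin.
Qed.

End mean_bounds.

(** * Freezing one of two independent coordinates *)

Section independence.
Context d (T : measurableType d) (R : realType) (P : probability T R).

Definition adapted (G : set (set T)) (f : T -> R) :=
  measurable_fun (setT : set (g_sigma_algebraType G)) f.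

Lemma sub_adapted (G H : set (set T)) f :
  (forall A, <<s G >> A -> <<s H >> A) -> adapted G f -> adapted H f.
Proof. by move=> GH mf mT B mB; apply: GH; apply: mf. Qed.

Lemma adapted_measurable (G : set (set T)) f :
  (forall A, <<s G >> A -> measurable A) -> adapted G f -> measurable_fun setT f.
Proof. by move=> Gm mf mT B mB; apply: Gm; apply: mf. Qed.

Lemma adapted_sum I (s : seq I) G (F : I -> T -> R) :
  (forall i, adapted G (F i)) -> adapted G (fun w => \sum_(i <- s) F i w).
Proof. by move=> h; apply: measurable_sum. Qed.

Section two.
Variables G1 G2 : set (set T).
Hypothesis mG1 : forall A, <<s G1 >> A -> measurable A.
Hypothesis mG2 : forall A, <<s G2 >> A -> measurable A.
Hypothesis indep : forall A B, <<s G1 >> A -> <<s G2 >> B ->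
  P (A `&` B) = (P A * P B)%E.

Let T1 := g_sigma_algebraType G1.
Let T2 := g_sigma_algebraType G2.

Let i1 (w : T) : T1 := w.
Let i2 (w : T) : T2 := w.
Let i12 (w : T) : (T1 * T2)%type := (w, w).

Let mi1 : measurable_fun setT i1.
Proof. by move=> _ B mB; rewrite setTI; exact: mG1. Qed.

Let mi2 : measurable_fun setT i2.
Proof. by move=> _ B mB; rewrite setTI; exact: mG2. Qed.

Let mi12 : measurable_fun setT i12.
Proof. exact: measurable_fun_pair mi1 mi2. Qed.

HB.instance Definition _ := isMeasurableFun.Build _ _ _ _ i1 mi1.
HB.instance Definition _ := isMeasurableFun.Build _ _ _ _ i2 mi2.
HB.instance Definition _ := isMeasurableFun.Build _ _ _ _ i12 mi12.

(** Under independence, the pair of the two coarsened copies of the sample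
space has the product law, so that means can be computed by first freezing
the first coordinate. *)
Lemma indep_mean_le (f : T1 * T2 -> R) (g : T -> R) (c : R) :
  measurable_fun setT f -> (forall z, 0 <= f z) ->
  (forall w, mean_le P (fun w' => f (w, w')) (g w)) -> mean_le P g c ->
  mean_le P (fun w => f (w, w)) c.
Proof.
move=> mf f0 fg [mg g0 gc].
have mEf : measurable_fun setT (EFin \o f) by exact/measurable_EFinP.
have Ef0 z : (0 <= (EFin \o f) z)%E by rewrite lee_fin.
split; [exact: measurableT_comp mf mi12 | by move=> w | ].
pose D1 := distribution P i1; pose D2 := distribution P i2.
have -> : (\int[P]_w (f (w, w))%:E = \int[distribution P i12]_z (EFin \o f) z)%E.
  by rewrite (ge0_integral_distribution i12 mEf Ef0).
have -> : (\int[distribution P i12]_z (EFin \o f) z =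
           \int[D1 \x D2]_z (EFin \o f) z)%E.
  apply: eq_measure_integral => A mA _.
  by apply/esym; apply: product_measure_unique => // B C mB mC; exact: indep.
rewrite (fubini_tonelli1 (EFin \o f) mEf Ef0).
have mF := measurable_fun_fubini_tonelli_F (m2 := D2) (EFin \o f) mEf Ef0.
have F0 x : (0 <= fubini_F D2 (EFin \o f) x)%E by exact: integral_ge0.
rewrite (ge0_integral_distribution i1 mF F0).
apply: le_trans gc; apply: ge0_le_integral => //.
- by move=> w _; exact: F0.
- exact: measurableT_comp mF mi1.
- exact/measurable_EFinP.
move=> w _ /=; rewrite /fubini_F.
rewrite (ge0_integral_distribution i2 (f := fun y => (f (i1 w, y))%:E)) //.
  by case: (fg w).
  apply/measurable_EFinP.
  exact: measurable_fun_pair2 mf.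
by move=> y; rewrite lee_fin.
Qed.

Section sqnorm4.
Context {I : Type} (s : seq I) (w : I -> R).
Hypothesis w_ge0 : forall i, 0 <= w i.

Lemma measurable_sqnorm4 d' (S : measurableType d') (F : I -> S -> R) :
  (forall i, measurable_fun setT (F i)) ->
  measurable_fun setT (fun z => sqnorm4 s w (F ^~ z)).
Proof.
move=> mF; apply: measurableT_comp.
  exact: continuous_measurable_fun (@sqrt_continuous R).
apply: measurable_sum => i; apply: measurable_funM => //.
exact: measurable_funX.
Qed.

(** Freeze X: the linear term of the expansion at X has mean 0 because Z is
centered and independent of X. *)
Lemma sqnorm4_add_indep (X Z : I -> T -> R) a b :
  (forall i, adapted G1 (X i)) -> (forall i, adapted G2 (Z i)) ->
  (forall i, integ P (Z i)) -> (forall i, \int[P]_u Z i u = 0) ->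
  mean_le P (fun u => sqnorm4 s w (X ^~ u)) a ->
  mean_le P (fun u => sqnorm4 s w (Z ^~ u)) b ->
  mean_le P (fun u => sqnorm4 s w (fun i => X i u + Z i u)) (a + 7 * b).
Proof.
move=> mX mZ iZ Z0 Xa Zb.
pose f (z : T1 * T2) := sqnorm4 s w (fun i => X i z.1 + Z i z.2).
apply: (indep_mean_le (f := f) (g := fun u => sqnorm4 s w (X ^~ u) + 7 * b)).
- apply: (@measurable_sqnorm4 _ (T1 * T2)%type (fun i z => X i z.1 + Z i z.2)).
  move=> i; apply: measurable_funD.
    exact: (measurableT_comp (mX i) measurable_fst).
  exact: (measurableT_comp (mZ i) measurable_snd).
- by move=> z; exact: sqnorm4_ge0.
- move=> u.
  have b0 : 0 <= b by exact: mean_le_ge0 Zb.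
  have mZT i : measurable_fun setT (Z i) by exact: adapted_measurable (mZ i).
  have iG : integ P (fun u' => sqnorm4_grad s w (X ^~ u) (Z ^~ u')).
    under eq_fun do rewrite grad_lin.
    by apply: integ_sum => i; exact: integZ.
  have iN : integ P (fun u' => 7 * sqnorm4 s w (Z ^~ u')).
    by apply: integZ; exact: mean_le_integ Zb.
  have iC := integ_cst P (sqnorm4 s w (X ^~ u)).
  pose g u' := sqnorm4 s w (X ^~ u) + sqnorm4_grad s w (X ^~ u) (Z ^~ u')
     + 7 * sqnorm4 s w (Z ^~ u').
  have fg u' : 0 <= f (u, u') <= g u'.
    by rewrite sqnorm4_ge0 /=; exact: sqnorm4_smooth.
  apply: (mean_le_le (g := g)) => //.
    apply: (@measurable_sqnorm4 _ T (fun i u' => X i u + Z i u')) => i.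
    exact: measurable_funD.
  apply: mean_leP.
  + by apply: integD => //; exact: integD.
  + by move=> u'; case/andP: (fg u') => /le_trans; apply.
  rewrite RintegralD //; last exact: integD.
  rewrite RintegralD // mean_cst RintegralZl //; last exact: mean_le_integ Zb.
  have -> : \int[P]_u' sqnorm4_grad s w (X ^~ u) (Z ^~ u') = 0.
    under eq_Rintegral do rewrite grad_lin.
    rewrite mean_sum; last by move=> i; exact: integZ.
    by rewrite big1 // => i _; rewrite RintegralZl //; [rewrite Z0 mulr0|exact: iZ].
  by rewrite addr0 lerD2l ler_pM2l // (mean_le_mean Zb).
apply: mean_leD => //; split => //.
  by move=> _; rewrite mulr_ge0 // (mean_le_ge0 Zb).
by rewrite integral_cst //= probability_setT mule1.
Qed.

End sqnorm4.
End two.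
End independence.

(** * Sums over independent processes *)

Section independent_sums.
Context d (T : measurableType d) (R : realType) (P : probability T R).
Variable Y : nat -> int -> {RV P >-> R}.
Hypothesis Yindep : independent_processes Y.

Definition noise_events (k : nat) : set (set T) :=
  \bigcup_t g_sigma_algebra_preimage (Y k t).

Lemma noise_events_measurable k A : <<s noise_events k >> A -> measurable A.
Proof.
apply: smallest_sub; first exact: sigma_algebra_measurable.
by move=> B [t _ [C mC <-]]; apply: measurable_funP.
Qed.

Lemma noise_adapted k t : adapted (noise_events k) (Y k t).
Proof.
move=> _ B mB; rewrite setTI; apply: sub_sigma_algebra.
by exists t => //; exists B => //; rewrite setTI.
Qed.

(** Intersections of events of single processes form a pi-system, on which the
product rule for finite families applies. *)
Definition past_events (m : nat) : set (set T) :=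
  [set \bigcap_(k in `I_m) B k | B in
    [set B : nat -> set T | forall k, <<s noise_events k >> (B k)]].

Lemma past_events_measurable m A : <<s past_events m >> A -> measurable A.
Proof.
apply: smallest_sub; first exact: sigma_algebra_measurable.
move=> B [C hC <-]; apply: fin_bigcap_measurable => // k _.
exact: noise_events_measurable.
Qed.

Lemma noise_setT k : <<s noise_events k >> setT.
Proof. exact: (@measurableT _ (g_sigma_algebraType (noise_events k))). Qed.

Lemma noise_past k m A : (k < m)%N ->
  <<s noise_events k >> A -> <<s past_events m >> A.
Proof.
move=> km hA; apply: sub_sigma_algebra.
exists (fun j => if j == k then A else setT).
  by move=> j /=; case: eqP => [->|_] //; exact: noise_setT.
apply/seteqP; split => w /=; first by move/(_ k km); rewrite eqxx.
by move=> Aw j _; case: eqP.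
Qed.

Lemma prob_bigcap m (B : nat -> set T) :
  (forall k, <<s noise_events k >> (B k)) ->
  P (\bigcap_(k in `I_m) B k) = (\prod_(k <- iota 0 m) P (B k))%E.
Proof.
move=> hB; have := @Yindep [fset k in iota 0 m]%fset B (fun k _ => hB k).
have -> : [set` [fset k in iota 0 m]%fset] = `I_m.
  by apply/seteqP; split => k /=; rewrite !inE /= mem_iota add0n.
move=> ->; apply: perm_big; apply: uniq_perm; rewrite ?fset_uniq ?iota_uniq //.
by move=> k; rewrite !inE.
Qed.

(** The product rule extends from the pi-system to the sigma-algebra it
generates, two finite measures being compared for fixed B. *)
Lemma past_indep m A B :
  <<s past_events m >> A -> <<s noise_events m >> B ->
  P (A `&` B) = (P A * P B)%E.
Proof.
move=> hA hB; have mB := noise_events_measurable hB.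
have fPB : P B \is a fin_num by exact: fin_num_measure.
have PB0 : 0 <= fine (P B) by rewrite fine_ge0.
pose m1 : {measure set T -> \bar R} := mrestr P mB.
pose m2 : {measure set T -> \bar R} := mscale (NngNum PB0) P.
suff : m1 A = m2 A by rewrite /m1 /m2 /= /mrestr /mscale /= fineK // muleC.
apply: (g_sigma_algebra_measure_unique (past_events m) _ (fun=> setT)) => //.
- by move=> C hC; apply: (@past_events_measurable m); exact: sub_sigma_algebra.
- move=> _; exists (fun=> setT); first by move=> k; exact: noise_setT.
  by rewrite bigcapT.
- by rewrite bigcup_const.
- move=> _ _ [C hC <-] [D hD <-]; exists (fun k => C k `&` D k).
    by move=> k; apply: (@measurableI _ (g_sigma_algebraType (noise_events k)));
      [exact: hC | exact: hD].
  by rewrite bigcapI.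
- move=> _ [C hC <-]; rewrite /m1 /m2 /= /mrestr /mscale /= fineK //.
  pose C' k := if (k < m)%N then C k else if k == m then B else setT.
  have -> : \bigcap_(k in `I_m) C k `&` B = \bigcap_(k in `I_m.+1) C' k.
    rewrite /C'; apply/seteqP; split => w /=.
      move=> [hw Bw] k /= kS; case: (ltnP k m) => [km|mk]; first exact: (hw k km).
      by rewrite eqn_leq mk andbT -ltnS kS.
    move=> hw; split => [k /= km|].
      by have := hw k (ltnW km); rewrite km.
    by have := hw m (ltnSn m); rewrite ltnn eqxx.
  rewrite !prob_bigcap //.
    rewrite -[m.+1]addn1 iotaD big_cat /= big_seq1 add0n /C' ltnn eqxx muleC.
    congr (_ * _)%E; apply: eq_big_seq => k; rewrite mem_iota add0n => /andP[_ ->].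
    by [].
  move=> k; rewrite /C'; case: ifP => _; first exact: hC.
  by case: eqP => [->|_] //; exact: noise_setT.
- move=> _; rewrite -ge0_fin_numE //; exact: fin_num_measure.
Qed.

Context {I : Type} (s : seq I) (w : I -> R).
Hypothesis w_ge0 : forall i, 0 <= w i.

Lemma sqnorm4_sum_centered (Z : nat -> I -> T -> R) (b : nat -> R) (m : nat) :
  (forall k i, adapted (noise_events k) (Z k i)) ->
  (forall k i, integ P (Z k i)) -> (forall k i, \int[P]_u Z k i u = 0) ->
  (forall k, mean_le P (fun u => sqnorm4 s w (fun i => Z k i u)) (b k)) ->
  mean_le P (fun u => sqnorm4 s w (fun i => \sum_(k < m) Z k i u))
    (7 * \sum_(k < m) b k).
Proof.
move=> aZ iZ Z0 Zb; elim: m => [|m IH].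
  rewrite big_ord0 mulr0; under eq_fun do under eq_fun do rewrite big_ord0.
  rewrite /sqnorm4; under eq_fun => u.
    under eq_bigr do rewrite expr0n /= mulr0.
    rewrite big1 // sqrtr0; over.
  exact: mean_le0.
rewrite big_ord_recr /= mulrDr.
under eq_fun do under eq_fun do rewrite big_ord_recr /=.
have aX i : adapted (past_events m) (fun u => \sum_(k < m) Z k i u).
  apply: adapted_sum => k; apply: sub_adapted (aZ k i) => A.
  exact: noise_past.
exact: (sqnorm4_add_indep (@past_events_measurable m)
  (@noise_events_measurable m) (@past_indep m) w_ge0 aX (aZ m) (iZ m) (Z0 m)
  IH (Zb m)).
Qed.

(** The l^4 norm is 2-smooth, so it behaves under sums of independent centered
vectors like a Hilbert norm up to a constant: it has type 2. Centering costs
another constant, by the inequality of Jensen. *)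
Lemma sqnorm4_sum_indep (Z : nat -> I -> T -> R) (b : nat -> R) (m : nat) :
  (forall k i, adapted (noise_events k) (Z k i)) ->
  (forall k i, integ P (Z k i)) ->
  (forall k, mean_le P (fun u => sqnorm4 s w (fun i => Z k i u)) (b k)) ->
  mean_le P
    (fun u => sqnorm4 s w (fun i => \sum_(k < m) (Z k i u - \int[P]_v Z k i v)))
    (42 * \sum_(k < m) b k).
Proof.
move=> aZ iZ Zb.
have mZ k i : measurable_fun setT (Z k i).
  exact: adapted_measurable (@noise_events_measurable k) (aZ k i).
have -> : 42 * \sum_(k < m) b k = 7 * \sum_(k < m) (6 * b k).
  by rewrite -mulr_sumr mulrA; congr (_ * _); ring.
apply: (@sqnorm4_sum_centered (fun k i u => Z k i u - \int[P]_v Z k i v)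
   (fun k => 6 * b k)) => [k i|k i|k i|k].
- by apply: measurable_funB => //; exact: aZ.
- by apply: integB => //; exact: integ_cst.
- rewrite RintegralB //; [|exact: iZ|exact: integ_cst].
  by rewrite mean_cst subrr.
set e := fun i => \int[P]_v Z k i v.
have eb : sqnorm4 s w e <= b k.
  have iN := mean_le_integ (Zb k).
  have iD i : integ P (fun u => Z k i u - e i).
    by apply: integB => //; exact: integ_cst.
  have iG : integ P (fun u => sqnorm4_grad s w e (fun i => Z k i u - e i)).
    under eq_fun do rewrite grad_lin.
    by apply: integ_sum => i; exact: integZ.
  apply: le_trans (mean_le_mean (Zb k)).
  have -> : sqnorm4 s w e = \int[P]_u (sqnorm4 s w e
      + sqnorm4_grad s w e (fun i => Z k i u - e i)).
    rewrite RintegralD //; [rewrite mean_cst|exact: integ_cst].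
    under eq_Rintegral do rewrite grad_lin.
    rewrite mean_sum; last by move=> i; exact: integZ.
    rewrite [X in _ + X]big1 ?addr0 // => i _; rewrite RintegralZl //; last exact: iD.
    rewrite RintegralB //; [|exact: iZ|exact: integ_cst].
    by rewrite mean_cst subrr mulr0.
  apply: le_Rintegral => //; first by apply: integD => //; exact: integ_cst.
  by move=> u _; exact: sqnorm4_convex.
have -> : 6 * b k = 3 * (b k + b k) by ring.
apply: (mean_le_le (g := fun u => 3 * (sqnorm4 s w (fun i => Z k i u) + b k))).
- have mZe i : measurable_fun setT (fun u => Z k i u - e i).
    exact: measurable_funB.
  exact: (measurable_sqnorm4 s w mZe).
- move=> u; rewrite sqnorm4_ge0 /=.
  apply: le_trans (sqnorm4_sub_le _ w_ge0 _ _) _.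
  by rewrite ler_pM2l // lerD2l.
apply: mean_leZ => //; apply: mean_leD => //; split => //.
  by move=> _; exact: mean_le_ge0 (Zb k).
by rewrite integral_cst //= probability_setT mule1.
Qed.

End independent_sums.

(** * Moments from cumulants *)

Section cumulants.
Context d (T : measurableType d) (R : realType) (P : probability T R).

Lemma fine_expectation (X : T -> R) : fine 'E_P[X] = \int[P]_w X w.
Proof. by rewrite unlock. Qed.

Section partitions.
Variables (r : nat) (X : 'I_r -> T -> R).
Hypothesis r_gt0 : (0 < r)%N.
Hypothesis X0 : forall i, \int[P]_w X i w = 0.

Let blk (B : {set 'I_r}) : R := fine 'E_P[fun w => \prod_(i in B) X i w].
Let term (pi : {set {set 'I_r}}) : R :=
  (-1) ^+ #|pi|.-1 * (#|pi|.-1)`!%:R * \prod_(B in pi) blk B.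

Let blk1 (i : 'I_r) : blk [set i]%SET = 0.
Proof.
by rewrite /blk; under eq_fun do rewrite big_set1; rewrite fine_expectation X0.
Qed.

Let term_singleton (pi : {set {set 'I_r}}) (i : 'I_r) :
  [set i]%SET \in pi -> term pi = 0.
Proof. by move=> hi; rewrite /term (bigD1 _ hi) /= blk1 mul0r mulr0. Qed.

Let setT_neq0 : [set: 'I_r]%SET != finset.set0.
Proof. by rewrite -card_gt0 cardsT card_ord. Qed.

Let partition_setT : finset.partition [set [set: 'I_r]]%SET [set: 'I_r]%SET.
Proof.
apply/and3P; split; last by rewrite inE eq_sym setT_neq0.
  by rewrite cover1.
by apply/finset.trivIsetP => A B; rewrite !inE => /eqP -> /eqP ->; rewrite eqxx.
Qed.

(** The partition into a single block contributes the moment itself. *)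
Lemma cumulant_bound :
  `|\int[P]_w \prod_i X i w| <= `|cumulant P X| +
  \sum_(pi : {set {set 'I_r}} | finset.partition pi [set: 'I_r]%SET &&
      (pi != [set [set: 'I_r]]%SET)) `|term pi|.
Proof.
have -> : \int[P]_w \prod_i X i w =
  cumulant P X - \sum_(pi : {set {set 'I_r}} | finset.partition pi [set: 'I_r]%SET &&
      (pi != [set [set: 'I_r]]%SET)) term pi.
  rewrite /cumulant (bigD1 [set [set: 'I_r]]%SET) //= addrK.
  rewrite cards1 /= fact0 expr0 !mul1r big_set1 fine_expectation.
  by apply: eq_Rintegral => w _; apply: eq_bigl => i; rewrite inE.
apply: le_trans (ler_normB _ _) _; rewrite lerD2l.
exact: ler_norm_sum.
Qed.

(** A singleton block makes the term of a partition vanish, because it contributes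
the mean of a centered variable. *)
Lemma block_proper (pi : {set {set 'I_r}}) (B : {set 'I_r}) :
  finset.partition pi [set: 'I_r]%SET -> pi != [set [set: 'I_r]]%SET ->
  B \in pi -> term pi != 0 -> (1 < #|B| < r)%N.
Proof.
move=> hpi piT Bpi t0; have /and3P[/eqP cov triv n0] := hpi.
apply/andP; split.
  rewrite ltn_neqAle card_gt0 andbC; apply/andP; split.
    by apply: contraNneq n0 => <-.
  apply: contraNneq t0 => /esym/eqP/cards1P[i Bi].
  by apply/eqP; apply: (@term_singleton _ i); rewrite -Bi.
rewrite ltn_neqAle -[X in (_ <= X)%N]card_ord max_card andbT.
apply: contraNneq piT => cB.
have BT : B = [set: 'I_r]%SET.
  by apply/eqP; rewrite eqEcard finset.subsetT cardsT card_ord cB leqnn.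
apply/eqP/setP => C; rewrite inE; apply/idP/eqP => [hC|->]; last by rewrite -BT.
apply/eqP; apply: contraNT n0 => CT.
have := finset.trivIsetP triv _ _ hC Bpi; rewrite BT CT => /(_ isT).
by rewrite -setI_eq0 finset.setIT => /eqP <-.
Qed.

End partitions.

Lemma cumulant2 (X : 'I_2 -> T -> R) : (forall i, \int[P]_w X i w = 0) ->
  `|\int[P]_w (X ord0 w * X ord_max w)| <= `|cumulant P X|.
Proof.
move=> X0; have := @cumulant_bound 2 X isT.
rewrite [X in _ + X]big1 ?addr0; last first.
  move=> pi /andP[hpi piT]; apply/eqP; rewrite normr_eq0.
  apply/negPn/negP => t0.
  have /and3P[/eqP cov _ _] := hpi.
  have : ord0 \in finset.cover pi by rewrite cov inE.
  move=> /finset.bigcupP[B Bpi _].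
  have := @block_proper 2 X X0 pi B hpi piT Bpi t0.
  by case: #|B| => [|[|[]]].
under eq_Rintegral do rewrite !big_ord_recl big_ord0 mulr1.
by rewrite (_ : lift ord0 ord0 = ord_max) //; apply/val_inj.
Qed.

Let pairing (i : 'I_3) : {set {set 'I_4}} :=
  [set [set ord0; lift ord0 i]; ~: [set ord0; lift ord0 i]]%SET.

(** Besides the single block, only the three pairings survive for four centered
variables: a block of three elements would leave a singleton. *)
Lemma pairingP (X : 'I_4 -> T -> R) (pi : {set {set 'I_4}}) :
  (forall i, \int[P]_w X i w = 0) ->
  finset.partition pi [set: 'I_4]%SET -> pi != [set [set: 'I_4]]%SET ->
  (-1) ^+ #|pi|.-1 * (#|pi|.-1)`!%:R *
    \prod_(B in pi) fine 'E_P[fun w => \prod_(i in B) X i w] != 0 ->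
  exists i, pi = pairing i.
Proof.
move=> X0 hpi piT t0.
have hB B (Bp : B \in pi) := @block_proper 4 X X0 pi B hpi piT Bp t0.
have /and3P[/eqP cov triv n0] := hpi.
have cover_ex x : exists2 B, B \in pi & x \in B.
  have : x \in finset.cover pi by rewrite cov inE.
  by move=> /finset.bigcupP[B ? ?]; exists B.
have hC B C : B \in pi -> C \in pi -> B != C -> C \subset ~: B.
  move=> Bp Cp BC; rewrite -finset.disjoints_subset disjoint_sym.
  exact: (finset.trivIsetP triv).
have cC (B : {set 'I_4}) : (#|~: B| = 4 - #|B|)%N.
  by have := cardsC B; rewrite card_ord; lia.
have card2 B : B \in pi -> #|B| = 2%N.
  move=> Bp; have := hB B Bp; case E : #|B| => [|[|[|[|]]]] // _.
  have : (0 < #|~: B|)%N by rewrite cC E.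
  rewrite card_gt0 => /finset.set0Pn[x]; rewrite inE => xB.
  have [C Cp xC] := cover_ex x.
  have BC : B != C by apply: contraNneq xB => ->.
  have := subset_leq_card (hC _ _ Bp Cp BC); rewrite cC E.
  by have := hB C Cp; case: #|C| => [|[|]].
have [B Bp B0] := cover_ex ord0.
have cB := card2 B Bp; move: (cB) => /eqP/cards2P[x [y [xy BE]]].
have [i Bi] : exists i : 'I_3, B = [set ord0; lift ord0 i]%SET.
  have lift_ex (z : 'I_4) : z != ord0 -> exists i : 'I_3, z = lift ord0 i.
    by move=> z0; case: (unliftP ord0 z) z0 => [i ->|->] //; exists i.
  move: B0; rewrite BE !inE => /orP[] /eqP xE.
    have [i yi] : exists i : 'I_3, y = lift ord0 i.
      by apply: lift_ex; rewrite eq_sym xE.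
    by exists i; rewrite -yi xE.
  have [i yi] : exists i : 'I_3, x = lift ord0 i.
    by apply: lift_ex; rewrite xE.
  by exists i; rewrite -yi xE finset.setUC.
exists i; rewrite /pairing -Bi; apply/setP => C; rewrite !inE.
have CB D : D \in pi -> D != B -> D = ~: B.
  move=> Dp DB; apply/eqP; rewrite eqEcard cC (card2 B Bp) (card2 D Dp) andbT.
  by apply: hC => //; rewrite eq_sym.
apply/idP/orP => [Cp|[/eqP ->|/eqP ->]] //.
  by have [->|/(CB _ Cp) ->] := eqVneq C B; [left|right].
have : (0 < #|~: B|)%N by rewrite cC (card2 B Bp).
rewrite card_gt0 => /finset.set0Pn[z]; rewrite inE => zB.
have [D Dp zD] := cover_ex z.
by rewrite -(CB D Dp) //; apply: contraNneq zB => <-.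
Qed.

Lemma cumulant4 (X : 'I_4 -> T -> R) : (forall i, \int[P]_w X i w = 0) ->
  `|\int[P]_w \prod_i X i w| <= `|cumulant P X| +
    \sum_(i < 3) `|\int[P]_w (X ord0 w * X (lift ord0 i) w)| *
      `|\int[P]_w \prod_(j in ~: [set ord0; lift ord0 i]%SET) X j w|.
Proof.
move=> X0; apply: le_trans (@cumulant_bound 4 X isT) _; rewrite lerD2l.
set F := fun pi : {set {set 'I_4}} => `|(-1) ^+ #|pi|.-1 * (#|pi|.-1)`!%:R *
    \prod_(B in pi) fine 'E_P[fun w => \prod_(i in B) X i w]|.
rewrite -[X in X <= _]/(\sum_(pi : {set {set 'I_4}} |
  finset.partition pi [set: 'I_4]%SET && (pi != [set [set: 'I_4]]%SET)) F pi).
have F0 pi : 0 <= F pi by exact: normr_ge0.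
have -> : \sum_(i < 3) `|\int[P]_w (X ord0 w * X (lift ord0 i) w)| *
      `|\int[P]_w \prod_(j in ~: [set ord0; lift ord0 i]%SET) X j w| =
   \sum_(i < 3) F (pairing i).
  apply: eq_bigr => i _; rewrite /F /pairing.
  set B := [set ord0; lift ord0 i]%SET.
  have BC : B != ~: B.
    by apply/eqP => /setP/(_ ord0); rewrite !inE eqxx.
  rewrite cards2 BC /= expr1 mulr1 mulN1r normrN.
  rewrite big_setU1 ?inE //= big_set1 normrM !fine_expectation.
  congr (`|_| * _); apply: eq_Rintegral => w _.
  by rewrite /B big_setU1 ?inE ?neq_lift //= big_set1.
have -> : \sum_(i < 3) F (pairing i) =
   \sum_(i < 3) \sum_(pi | pi == pairing i) F pi.
  by apply: eq_bigr => i _; rewrite big_pred1_eq.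
rewrite (exchange_big_dep predT) //= big_mkcond; apply: ler_sum => pi _.
case: ifP => [/andP[hpi piT]|_]; last exact: sumr_ge0.
have [t0|t0] := eqVneq (F pi) 0.
  by rewrite /F in t0 *; rewrite t0; exact: sumr_ge0.
move: (t0); rewrite /F normr_eq0 => t0'.
have [i pii] := pairingP X0 hpi piT t0'.
by rewrite (bigD1 i) ?pii //= lerDl sumr_ge0.
Qed.

End cumulants.

(** * Moments of sums of the noise *)

Lemma sum_le_esum (R : realType) (I : choiceType) (s : seq I) (a : I -> \bar R) :
  uniq s -> (forall i, 0 <= a i)%E ->
  (\sum_(i <- s) a i <= \esum_(i in [set: I]) a i)%E.
Proof.
move=> us a0; apply: esum_ge; exists [set` s].
  by split => //; exact: finite_seq.
by rewrite -fsbig_seq.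
Qed.

Section moments.
Context d (T : measurableType d) (R : realType) (P : probability T R).
Variable Y : nat -> int -> {RV P >-> R}.
Hypothesis Ystat : forall k, centered_4th_order_stationary (Y k).
Hypothesis YD2 : D2 Y.

(** Stationarity moves the first time to 1, where the summability hypothesis is
stated; the supremum over the processes makes the bound uniform in k. *)
Lemma cumulants_summable r : (1 <= r <= 3)%N ->
  exists2 K : R, 0 <= K & forall k (t0 : int) (s : seq (r.-tuple int)), uniq s ->
    \sum_(t <- s) `|cumulant P (fun i : 'I_r.+1 => Y k (nth 0 (t0 :: t) i))| <= K.
Proof.
move=> hr; have hK := YD2 hr.
set a := (X in esum _ X) in hK.
have a0 t : (0 <= a t)%E.
  by apply: le_trans (ereal_sup_ubound (imageT _ 0%N)); rewrite lee_fin normr_ge0.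
set K := esum _ _ in hK.
have K0 : (0 <= K)%E by apply: esum_ge0 => t _; exact: a0.
have Kfin : K \is a fin_num by rewrite ge0_fin_numE.
exists (fine K); first exact: fine_ge0.
move=> k t0 s us.
pose f (t : r.-tuple int) : r.-tuple int := [tuple of map (fun x => x - t0) t].
have finj : injective f.
  move=> t t' /(congr1 val) /= /inj_map h; apply/val_inj/h.
  by move=> x y /addIr.
have ufs : uniq (map f s) by rewrite map_inj_uniq.
rewrite -lee_fin fineK // -sumEFin.
apply: le_trans (sum_le_esum ufs a0); rewrite big_map.
apply: lee_sum => t _; apply: ereal_sup_ubound; exists k => //; congr (`|_|%:E).
have [_ _ hst] := Ystat k.
apply: (hst r _ (fun i : 'I_r.+1 => tnth [tuple of 0 :: f t] i + 1)
    (fun i : 'I_r.+1 => nth 0 (t0 :: t) i)).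
  by rewrite ltnS; case/andP: hr.
move=> i; rewrite !(tnth_nth 0) /=.
case: i => [[|i] hi] /=; first by rewrite !subrr.
by rewrite (nth_map 0) ?size_tuple //; ring.
Qed.

Lemma mean_noise k t : \int[P]_u Y k t u = 0.
Proof.
by have [h _ _] := Ystat k; rewrite -fine_expectation h.
Qed.

Lemma integ_noise4 k t : integ P (fun u => Y k t u ^+ 4).
Proof.
have [_ h _] := Ystat k; have := h t 4%N isT.
rewrite unlock => h4; apply/integrableP; split.
  exact/measurable_EFinP/measurable_funX.
apply: le_lt_trans h4; rewrite le_eqVlt; apply/orP; left; apply/eqP.
by apply: eq_integral => u _; rewrite /= normrX.
Qed.

Lemma integ_noise_prod4 k t1 t2 t3 t4 :
  integ P (fun u => Y k t1 u * Y k t2 u * (Y k t3 u * Y k t4 u)).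
Proof.
apply: (@integ_le _ _ _ _ _ (fun u =>
  (Y k t1 u ^+ 4 + Y k t2 u ^+ 4) + (Y k t3 u ^+ 4 + Y k t4 u ^+ 4))).
- by apply: measurable_funM; exact: measurable_funM.
- by apply: integD; apply: integD; exact: integ_noise4.
move=> u; move: (Y k t1 u) (Y k t2 u) (Y k t3 u) (Y k t4 u) => a b c e.
have young2 (x y : R) : `|x * y| <= (x ^+ 2 + y ^+ 2) / 2.
  rewrite ler_norml; have := sqr_ge0 (x + y); have := sqr_ge0 (x - y).
  by move=> ? ?; apply/andP; split; nra.
have h1 := young2 (a * b) (c * e).
have h2 (x y : R) : (x * y) ^+ 2 <= (x ^+ 4 + y ^+ 4) / 2.
  have := young2 (x ^+ 2) (y ^+ 2).
  by rewrite -exprMn ger0_norm ?sqr_ge0 // -!exprM.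
have := h2 a b; have := h2 c e; move: h1.
have p4 (x : R) : 0 <= x ^+ 4 by exact: exprn_even_ge0.
have := p4 a; have := p4 b; have := p4 c; have := p4 e.
by clear h2 young2 p4; lra.
Qed.

Lemma integ_noise_prod2 k t1 t2 : integ P (fun u => Y k t1 u * Y k t2 u).
Proof.
apply: (@integ_le _ _ _ _ _ (fun u => 1 + (Y k t1 u ^+ 4 + Y k t2 u ^+ 4))).
- exact: measurable_funM.
- apply: integD; first exact: integ_cst.
  by apply: integD; exact: integ_noise4.
move=> u; move: (Y k t1 u) (Y k t2 u) => a b.
have h (x : R) : x ^+ 2 <= 1 + x ^+ 4.
  by have := sqr_ge0 (x ^+ 2 - 1); have := sqr_ge0 x; rewrite sqrrB -exprM; lra.
rewrite ler_norml; have := sqr_ge0 (a + b); have := sqr_ge0 (a - b).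
have := h a; have := h b; have := sqr_ge0 (a ^+ 2); have := sqr_ge0 (b ^+ 2).
by rewrite -!exprM => *; apply/andP; split; nra.
Qed.

Lemma integ_noise k t : integ P (Y k t).
Proof.
apply: (@integ_le _ _ _ _ _ (fun u => 1 + Y k t u * Y k t u)) => //.
  by apply: integD; [exact: integ_cst|exact: integ_noise_prod2].
move=> u; rewrite ler_norml; have := sqr_ge0 (Y k t u + 1).
have := sqr_ge0 (Y k t u - 1); have := sqr_ge0 (Y k t u).
by rewrite expr2 => *; apply/andP; split; nra.
Qed.

Let cov k a b : R := \int[P]_u (Y k a u * Y k b u).

Lemma autocov_summable : exists2 K : R, 0 <= K &
  forall k (a : int) (s : seq int), uniq s -> \sum_(b <- s) `|cov k a b| <= K.
Proof.
have [K K0 hK] := @cumulants_summable 1 isT.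
exists K => // k a s us.
have us' : uniq (map (fun b => [tuple b]) s).
  by rewrite map_inj_uniq // => x y /(congr1 val) /= [].
apply: le_trans (hK k a _ us'); rewrite big_map; apply: ler_sum => b _.
apply: (@cumulant2 _ _ _ _ (fun i : 'I_2 => Y k (nth 0 [:: a; b] i))) => i.
exact: mean_noise.
Qed.

Lemma mixed_moment4 k a b c e :
  `|\int[P]_u (Y k a u * Y k b u * (Y k c u * Y k e u))| <=
  `|cumulant P (fun i : 'I_4 => Y k (nth 0 [:: a; b; c; e] i))|
  + (`|cov k a b| * `|cov k c e| + `|cov k a c| * `|cov k b e|
     + `|cov k a e| * `|cov k b c|).
Proof.
pose X (i : 'I_4) : T -> R := Y k (nth 0 [:: a; b; c; e] i).
have prodE (A : {set 'I_4}) u :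
    \prod_(j in A) X j u =
    (if ord0 \in A then Y k a u else 1) *
    ((if lift ord0 ord0 \in A then Y k b u else 1) *
     ((if lift ord0 (lift ord0 ord0) \in A then Y k c u else 1) *
      (if lift ord0 (lift ord0 (lift ord0 ord0)) \in A then Y k e u else 1))).
  by rewrite big_mkcond !big_ord_recl big_ord0 Monoid.mulm1.
have pairE (i : 'I_3) (G : T -> R) :
    (forall u, \prod_(j in ~: [set ord0; lift ord0 i]%SET) X j u = G u) ->
    \int[P]_u \prod_(j in ~: [set ord0; lift ord0 i]%SET) X j u = \int[P]_u G u.
  by move=> h; apply: eq_Rintegral => u _.
have := @cumulant4 _ _ _ P X (fun i => mean_noise k _).
rewrite !big_ord_recl big_ord0 addr0.
rewrite (pairE _ (fun u => Y k c u * Y k e u)); last first.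
  by move=> u; rewrite prodE !inE /= !mul1r.
rewrite (pairE _ (fun u => Y k b u * Y k e u)); last first.
  by move=> u; rewrite prodE !inE /= !mul1r.
rewrite (pairE _ (fun u => Y k b u * Y k c u)); last first.
  by move=> u; rewrite prodE !inE /= !mul1r mulr1.
have -> : \int[P]_u (\prod_i X i u) =
    \int[P]_u (Y k a u * Y k b u * (Y k c u * Y k e u)).
  by apply: eq_Rintegral => u _; rewrite !big_ord_recl big_ord0 mulr1 mulrA.
by rewrite -!addrA.
Qed.

Lemma cov_sums_le : exists2 K : R, 0 <= K &
  forall k (s s' : seq int), uniq s' ->
    \sum_(a <- s) \sum_(b <- s') `|cov k a b| <= K * (size s)%:R.
Proof.
have [K K0 hK] := autocov_summable.
exists K => // k s s' us'.
apply: (@le_trans _ _ (\sum_(a <- s) K)); first by apply: ler_sum => a _; exact: hK.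
by rewrite big_const_seq count_predT iter_addr_0 mulr_natr.
Qed.

(** The cumulant of order four contributes a multiple of the length, each of the
three pairings a multiple of the squared length. *)
Lemma moment4_sum_le : exists2 C : R, 0 <= C &
  forall k (s : seq int), uniq s ->
    mean_le P (fun u => (\sum_(a <- s) Y k a u) ^+ 4) (C * (size s)%:R ^+ 2).
Proof.
have [K K0 hK] := autocov_summable.
have [K4 K40 hK4] := @cumulants_summable 3 isT.
exists (K4 + 3 * K ^+ 2); first by rewrite addr_ge0 // mulr_ge0 // sqr_ge0.
move=> k s us; set L : R := (size s)%:R.
have L0 : 0 <= L by exact: ler0n.
have constE (c : R) : \sum_(a <- s) c = c * L.
  by rewrite big_const_seq count_predT iter_addr_0 mulr_natr.
have expand u : (\sum_(a <- s) Y k a u) ^+ 4 =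
    \sum_(a <- s) \sum_(b <- s) \sum_(c <- s) \sum_(e <- s)
      (Y k a u * Y k b u * (Y k c u * Y k e u)).
  rewrite (exprM _ 2 2) !expr2 big_distrlr /= big_distrl /=.
  apply: eq_bigr => a _; rewrite big_distrl /=; apply: eq_bigr => b _.
  rewrite big_distrr /=; apply: eq_bigr => c _.
  by rewrite big_distrr.
have i1 a b c e := integ_noise_prod4 k a b c e.
have i2 a b c := integ_sum s (i1 a b c).
have i3 a b := integ_sum s (i2 a b).
have i4 a := integ_sum s (i3 a).
have i5 := integ_sum s i4.
apply: mean_leP.
- by apply: eq_integrable i5 => // u _ /=; rewrite expand.
- by move=> u; exact: exprn_even_ge0.
under eq_Rintegral do rewrite expand.
rewrite mean_sum //.
apply: (@le_trans _ _ (\sum_(a <- s) (K4 + 3 * (K ^+ 2 * L)))); last first.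
  rewrite constE.
  have : L <= L ^+ 2.
    by rewrite /L -natrX ler_nat; case: (size s) => // n; rewrite expnS leq_pmulr.
  by have := mulr_ge0 K40 L0; nra.
apply: ler_sum => a _.
rewrite mean_sum //.
apply: (@le_trans _ _ (\sum_(b <- s) \sum_(c <- s) \sum_(e <- s)
  (`|cumulant P (fun i : 'I_4 => Y k (nth 0 [:: a; b; c; e] i))|
  + (`|cov k a b| * `|cov k c e| + `|cov k a c| * `|cov k b e|
     + `|cov k a e| * `|cov k b c|)))).
  apply: ler_sum => b _; rewrite mean_sum //; apply: ler_sum => c _.
  rewrite mean_sum //; apply: ler_sum => e _.
  by apply: le_trans (ler_norm _) _; exact: mixed_moment4.
under eq_bigr do under eq_bigr do rewrite !big_split /=.
under eq_bigr do rewrite !big_split /=.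
rewrite !big_split /=.
have covK x : \sum_(y <- s) `|cov k x y| <= K by exact: hK.
have covS x : 0 <= \sum_(y <- s) `|cov k x y| by exact: sumr_ge0.
apply: lerD.
  pose tup (x : (int * int) * int) : 3.-tuple int := [tuple x.1.1; x.1.2; x.2].
  pose S := map tup [seq (x, y) | x <- [seq (x, y) | x <- s, y <- s], y <- s].
  have uS : uniq S.
    rewrite map_inj_uniq; last first.
      by move=> [[x y] z] [[x' y'] z'] /(congr1 val) /= [-> -> ->].
    apply: allpairs_uniq => //; last by move=> [? ?] [? ?].
    by apply: allpairs_uniq => // -[? ?] [? ?].
  by have := hK4 k a S uS; rewrite big_map !big_allpairs /=.
have KK : K * K = K ^+ 2 by rewrite expr2.
have -> : 3 * (K ^+ 2 * L) = K ^+ 2 * L + K ^+ 2 * L + K ^+ 2 * L by ring.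
apply: lerD; first apply: lerD.
- have -> : \sum_(b <- s) \sum_(c <- s) \sum_(e <- s) `|cov k a b| * `|cov k c e|
     = (\sum_(b <- s) `|cov k a b|) * \sum_(c <- s) \sum_(e <- s) `|cov k c e|.
    rewrite big_distrl; apply: eq_bigr => b _; rewrite big_distrr.
    by apply: eq_bigr => c _; rewrite big_distrr.
  rewrite -KK -mulrA; apply: ler_pM => //; first by apply: sumr_ge0 => c _.
  by rewrite -constE; apply: ler_sum.
- rewrite -constE; apply: ler_sum => b _.
  by rewrite -big_distrlr /= -KK; apply: ler_pM.
- rewrite -constE; apply: ler_sum => b _.
  under eq_bigr do under eq_bigr do rewrite mulrC.
  by rewrite -big_distrlr /= -KK; apply: ler_pM.
Qed.

End moments.

(** * Maximal inequalities for noise excursions *)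

Section noise_sums.
Context d (T : measurableType d) (R : realType) (P : probability T R).
Variable Y : nat -> int -> {RV P >-> R}.

Definition noise_sum (k j : nat) (u : T) : R := psum (fun t => Y k t u) j.

Lemma noise_sumB k (i j : nat) u : (i <= j)%N ->
  noise_sum k j u - noise_sum k i u =
  \sum_(a <- map Posz (index_iota i.+1 j.+1)) Y k a u.
Proof. by move=> ij; rewrite /noise_sum psumB // big_map. Qed.

Lemma noise_sumE k j u :
  noise_sum k j u = \sum_(a <- map Posz (index_iota 1 j.+1)) Y k a u.
Proof. by rewrite big_map. Qed.

Lemma uniq_block (i j : nat) : uniq (map Posz (index_iota i j)).
Proof. by rewrite map_inj_uniq ?iota_uniq // => x y [->]. Qed.

Lemma adapted_noise_sum k j : adapted (noise_events Y k) (noise_sum k j).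
Proof.
have -> : noise_sum k j = fun u => \sum_(a <- map Posz (index_iota 1 j.+1)) Y k a u.
  by apply/funext => u; rewrite noise_sumE.
by apply: adapted_sum => a; exact: noise_adapted.
Qed.

Lemma measurable_noise_sum k j : measurable_fun setT (noise_sum k j).
Proof.
exact: adapted_measurable (@noise_events_measurable _ _ _ P Y k)
  (@adapted_noise_sum k j).
Qed.

Hypothesis Ystat : forall k, centered_4th_order_stationary (Y k).
Hypothesis YD2 : D2 Y.

Lemma integ_noise_sum k j : integ P (noise_sum k j).
Proof.
have := integ_sum (map Posz (index_iota 1 j.+1)) (fun a => integ_noise Ystat k a).
by apply: eq_integrable => // u _ /=; rewrite noise_sumE.
Qed.

Lemma mean_noise_sum k j : \int[P]_u noise_sum k j u = 0.
Proof.
under eq_Rintegral do rewrite noise_sumE.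
rewrite mean_sum; last by move=> a; exact: integ_noise.
by rewrite big1 // => a _; exact: mean_noise.
Qed.

Lemma noise_sum_moment4 : exists2 C : R, 0 <= C & forall k a b,
  mean_le P (fun u => (noise_sum k b u - noise_sum k a u) ^+ 4)
    (C * (b%:R - a%:R) ^+ 2).
Proof.
have [C C0 hC] := moment4_sum_le Ystat YD2.
exists C => // k a b; wlog ab : a b / (a <= b)%N.
  move=> h; case: (leqP a b) => [/h //|/ltnW /h].
  rewrite -(sqrrN (a%:R - b%:R)) opprB.
  have swap (x y : R) : (x - y) ^+ 4 = (y - x) ^+ 4 by ring.
  by under eq_fun do rewrite swap.
have := hC k _ (uniq_block a.+1 b.+1).
rewrite size_map size_iota subSS natrB // => h.
by under eq_fun do rewrite noise_sumB //.
Qed.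

Lemma integ_noise_sumM k i a b :
  integ P (fun u => noise_sum k i u * (noise_sum k b u - noise_sum k a u)).
Proof.
have h x y : integ P (fun u => noise_sum k x u * noise_sum k y u).
  have := integ_sum (map Posz (index_iota 1 x.+1)) (fun a1 =>
    integ_sum (map Posz (index_iota 1 y.+1)) (fun a2 =>
       integ_noise_prod2 Ystat k a1 a2)).
  by apply: eq_integrable => // u _ /=; rewrite !noise_sumE big_distrlr.
apply: eq_integrable (integB (h i b) (h i a)) => // u _ /=.
by rewrite mulrBr.
Qed.

(** The covariance of a short block with an arbitrarily long sum is of the order
of the short length, since autocovariances are summable. *)
Lemma noise_sum_cov : exists2 C : R, 0 <= C & forall k j a b,
  `|\int[P]_u (noise_sum k j u * (noise_sum k b u - noise_sum k a u))| <=
    C * `|b%:R - a%:R|.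
Proof.
have [C C0 hC] := cov_sums_le Ystat YD2.
exists C => // k j a b; wlog ab : a b / (a <= b)%N.
  move=> h; case: (leqP a b) => [/h //|/ltnW /h].
  rewrite (distrC b%:R); apply: le_trans.
  have -> : \int[P]_u (noise_sum k j u * (noise_sum k b u - noise_sum k a u)) =
     -1 * \int[P]_u (noise_sum k j u * (noise_sum k a u - noise_sum k b u)).
    rewrite -RintegralZl //; last exact: integ_noise_sumM.
    by apply: eq_Rintegral => u _; ring.
  by rewrite mulN1r normrN.
rewrite (ger0_norm (x := b%:R - a%:R)) ?subr_ge0 ?ler_nat // -natrB //.
have := hC k (map Posz (index_iota a.+1 b.+1)) _ (uniq_block 1 j.+1).
rewrite size_map size_iota subSS; apply: le_trans.
have -> : \int[P]_u (noise_sum k j u * (noise_sum k b u - noise_sum k a u)) =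
  \sum_(x <- map Posz (index_iota a.+1 b.+1))
    \sum_(y <- map Posz (index_iota 1 j.+1)) \int[P]_u (Y k x u * Y k y u).
  under eq_Rintegral do rewrite noise_sumB // noise_sumE mulrC big_distrlr /=.
  rewrite mean_sum; last first.
    by move=> x; apply: integ_sum => y; exact: integ_noise_prod2.
  apply: eq_bigr => x _; rewrite mean_sum // => y.
  exact: integ_noise_prod2.
apply: le_trans (ler_norm_sum _ _ _) _; apply: ler_sum => x _.
exact: ler_norm_sum.
Qed.

Lemma noise_sum0 k u : noise_sum k 0 u = 0.
Proof. by rewrite /noise_sum /psum big_geq. Qed.

End noise_sums.

Section maximal.
Context d (T : measurableType d) (R : realType) (P : probability T R).
Variable Y : nat -> int -> {RV P >-> R}.
Hypothesis Yindep : independent_processes Y.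
Variable A : R.
Local Notation S := (noise_sum Y).

(** The walk along which the maxima are taken: p h is a split point at
distance at most h from p 0, to the right or to the left. *)
Variable p : nat -> nat.
Hypothesis p_lip : forall h h', `|(p h)%:R - (p h')%:R| <= `|h%:R - h'%:R| :> R.
Hypothesis A0 : 0 <= A.
Hypothesis S4 : forall k a b,
  mean_le P (fun u => (S k b u - S k a u) ^+ 4) (A / 1000 * (b%:R - a%:R) ^+ 2).

Definition excursion k h u : R := S k (p h) u - S k (p 0) u.
Local Notation U := excursion.

Lemma adapted_excursion k h : adapted (noise_events Y k) (U k h).
Proof. by apply: measurable_funB; exact: adapted_noise_sum. Qed.

Lemma measurable_excursion k h : measurable_fun setT (U k h).
Proof. by apply: measurable_funB; exact: measurable_noise_sum. Qed.

Lemma excursion0 k u : U k 0 u = 0.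
Proof. by rewrite /excursion subrr. Qed.

Let dU k (i : nat * nat * nat) u : R := U k i.2 u - U k i.1.2 u.

Let dUE k i u : dU k i u = S k (p i.2) u - S k (p i.1.2) u.
Proof. by rewrite /dU /excursion; ring. Qed.

Let adU k i : adapted (noise_events Y k) (dU k i).
Proof. by apply: measurable_funB; exact: adapted_excursion. Qed.

Let mdU k i : measurable_fun setT (dU k i).
Proof. by apply: measurable_funB; exact: measurable_excursion. Qed.

Variable r : nat.
Local Notation Phi := (sqnorm4 (chain r 0) chain_weight).
Let w0 := @chain_weight_ge0 R.
Let z : R := 2 ^+ r.
Let z0 : 0 < z. Proof. exact: exprn_gt0. Qed.

Let A1000 : 0 <= A / 1000.
Proof. exact: divr_ge0 A0 (ler0n R 1000). Qed.

Let Phi_sqr k : mean_le P (fun u => Phi (fun i => dU k i u) ^+ 2) (A * z ^+ 2).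
Proof.
under eq_fun do rewrite sqr_sqnorm4 //.
have h i : mean_le P (fun u => chain_weight i * dU k i u ^+ 4)
    (A / 1000 * (chain_weight i * (i.2%:R - i.1.2%:R) ^+ 2)).
  rewrite mulrCA; apply: (mean_leZ (w0 i)).
  under eq_fun do rewrite dUE.
  apply: mean_leW (S4 _ _ _); apply: ler_wpM2l.
    exact: A1000.
  rewrite -(real_normK (num_real (_ - (p i.1.2)%:R))).
  rewrite -(real_normK (num_real (_ - i.1.2%:R))).
  by rewrite ler_sqr ?nnegrE ?normr_ge0.
apply: mean_leW (mean_le_sum _ h); rewrite -mulr_sumr.
have := @chain_weighted_lengths R r 0.
have -> : (4 : R) ^+ r = z ^+ 2.
  by rewrite /z -exprM mulnC exprM; congr (_ ^+ _); ring.
move=> h1; apply: le_trans (ler_wpM2l A1000 h1) _.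
have thousand : (1000 : R) != 0 by rewrite pnatr_eq0.
by rewrite mulrA (divfK thousand).
Qed.

Let adapted_Phi k : adapted (noise_events Y k) (fun u => Phi (fun i => dU k i u)).
Proof.
exact: (@measurable_sqnorm4 R _ (chain r 0) chain_weight _
  (g_sigma_algebraType (noise_events Y k)) (dU k) (@adU k)).
Qed.

(** The factor z / al balances the two terms of the inequality
2 a^2 b <= l a^4 + b^2 / l, so that fourth moments of the random weight and of
the increments suffice. *)
Let Phi_weighted k (a : T -> R) (al : R) : 0 < al ->
  measurable_fun setT a -> mean_le P (fun u => a u ^+ 4) (al ^+ 2) ->
  mean_le P (fun u => Phi (fun i => a u * dU k i u)) ((1 + A) * z * al).
Proof.
move=> al0 ma ha.
have l0 : 0 < z / al by rewrite divr_gt0.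
have li0 : 0 < al / z by rewrite divr_gt0.
have h := mean_leD (mean_leZ (ltW l0) ha) (mean_leZ (ltW li0) (Phi_sqr k)).
have E : z / al * al ^+ 2 + al / z * (A * z ^+ 2) = (1 + A) * z * al.
  by field; rewrite !gt_eqF.
rewrite E in h; apply: (mean_le_le _ _ h).
  apply: (@measurable_sqnorm4 R _ (chain r 0) chain_weight _ T
     (fun i u => a u * dU k i u)) => i.
  exact: measurable_funM.
move=> u; rewrite sqnorm4_ge0 sqnorm4_scale /=.
set y := Phi _; set x := a u.
have -> : z / al * x ^+ 4 + al / z * y ^+ 2 =
  (z / al) * ((x ^+ 2) ^+ 2 + (al / z * y) ^+ 2).
  by rewrite -exprM; field; rewrite !gt_eqF.
have -> : x ^+ 2 * y = z / al * (x ^+ 2 * (al / z * y)).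
  by field; rewrite !gt_eqF.
rewrite ler_pM2l //; move: (x ^+ 2) (al / z * y) => e f.
by have := sqr_ge0 (e - f); have := sqr_ge0 e; have := sqr_ge0 f; nra.
Qed.

Let Phi_mean k : mean_le P (fun u => Phi (fun i => dU k i u)) ((1 + A) * z).
Proof.
have h1 : mean_le P (fun u : T => (1 : R) ^+ 4) (1 ^+ 2).
  apply: mean_leP; first exact: integ_cst.
    by move=> _; rewrite expr1n.
  by rewrite !expr1n mean_cst.
have := @Phi_weighted k (fun=> 1) 1 ltr01 (@measurable_cst _ _ _ _ _ _) h1.
rewrite mulr1; under eq_fun do under eq_fun do rewrite mul1r.
by [].
Qed.

Let excursion_sqr_le k h u : (h <= 2 ^ r)%N ->
  U k h u ^+ 2 <= Phi (fun i => dU k i u).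
Proof.
move=> hr; rewrite -ler_sqr ?nnegrE ?sqr_ge0 ?sqnorm4_ge0 // sqr_sqnorm4 //.
rewrite -exprM; have := chain_increment_le (U k ^~ u) 0 hr.
by rewrite add0n excursion0 subr0.
Qed.

(** The squared excursions are positive, so only their fluctuation around the
mean is controlled by independence, and the threshold has to exceed the
mean. *)
Lemma excursion_norm_prob (m : nat) (x : R) :
  2 * (m%:R * ((1 + A) * z)) <= x -> 0 < x ->
  prob_le P [set u | exists2 h, (h <= 2 ^ r)%N & x < \sum_(k < m) U k h u ^+ 2]
    (168 * A * (m%:R * z ^+ 2) / x ^+ 2).
Proof.
move=> xm x0.
pose M k u := Phi (fun i => dU k i u).
have one4 (y : R) : sqnorm4 [:: tt] (fun=> 1) (fun=> y) = y ^+ 2.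
  rewrite /sqnorm4 big_seq1 mul1r (exprM _ 2 2) sqrtr_sqr ger0_norm //.
  exact: sqr_ge0.
have h2 k : mean_le P (fun u => sqnorm4 [:: tt] (fun=> 1) (fun=> M k u)) (A * z ^+ 2).
  by under eq_fun do rewrite one4; exact: Phi_sqr.
have := @sqnorm4_sum_indep _ _ _ _ _ Yindep unit [:: tt] (fun=> 1)
  (fun=> @ler01 R) (fun k _ => M k) (fun=> A * z ^+ 2) m
  (fun k _ => @adapted_Phi k) (fun k _ => mean_le_integ (Phi_mean k)) h2.
under eq_fun do rewrite one4.
move=> hM.
have x2 : 0 < (x / 2) ^+ 2 by rewrite exprn_gt0 // divr_gt0.
have := prob_le_markov x2 hM.
have -> : \sum_(k < m) A * z ^+ 2 = A * z ^+ 2 * m%:R.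
  by rewrite sumr_const card_ord mulr_natr.
have -> : 42 * (A * z ^+ 2 * m%:R) / (x / 2) ^+ 2 =
          168 * A * (m%:R * z ^+ 2) / x ^+ 2 by field; rewrite gt_eqF.
apply: prob_leS => u /= [j jr xj].
have sumM : x < \sum_(k < m) M k u.
  by apply: lt_le_trans xj _; apply: ler_sum => k _; exact: excursion_sqr_le.
have meanM : \sum_(k < m) \int[P]_v M k v <= x / 2.
  apply: le_trans (_ : \sum_(k < m) (1 + A) * z <= _).
    by apply: ler_sum => k _; exact: mean_le_mean (Phi_mean k).
  by rewrite sumr_const card_ord -[leLHS]mulr_natr; lra.
rewrite sumrB ltr_sqr ?nnegrE; first by lra.
  by rewrite divr_ge0 // ltW.
by lra.
Qed.

(** The weights a k may be random and depend on the increments, as long as they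
belong to the k-th process: independence is only used across processes. The
products a k * U k h are only known to have second moments, which suffice since
the means of sqnorm4 are of second order. *)
Lemma excursion_lin_prob (m : nat) (a : nat -> T -> R) (al : nat -> R) (x : R) :
  (forall k, adapted (noise_events Y k) (a k)) -> (forall k, 0 < al k) ->
  (forall k, mean_le P (fun u => a k u ^+ 4) (al k ^+ 2)) ->
  (forall k h, integ P (fun u => a k u * U k h u)) -> 0 < x ->
  prob_le P [set u | exists2 h, (h <= 2 ^ r)%N &
      x < `|\sum_(k < m) (a k u * U k h u - \int[P]_v (a k v * U k h v))|]
    (42 * ((1 + A) * z * \sum_(k < m) al k) / x ^+ 2).
Proof.
move=> aa al0 ha ia x0.
have ma k : measurable_fun setT (a k).
  exact: adapted_measurable (@noise_events_measurable _ _ _ P Y k) (aa k).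
pose Z k i u := a k u * dU k i u.
have ZE k i u : Z k i u = a k u * U k i.2 u - a k u * U k i.1.2 u.
  by rewrite /Z /dU mulrBr.
have iZ k i : integ P (Z k i).
  by apply: eq_integrable (integB (ia k i.2) (ia k i.1.2)) => // u _ /=; rewrite ZE.
have EZ k i : \int[P]_u Z k i u =
    \int[P]_v (a k v * U k i.2 v) - \int[P]_v (a k v * U k i.1.2 v).
  by rewrite -RintegralB //; [apply: eq_Rintegral => u _|exact: ia|exact: ia].
have aZ k i : adapted (noise_events Y k) (Z k i).
  by apply: measurable_funM; [exact: aa|exact: adU].
have := @sqnorm4_sum_indep _ _ _ _ _ Yindep _ (chain r 0) chain_weight w0
  Z (fun k => (1 + A) * z * al k) m aZ iZ
  (fun k => @Phi_weighted k (a k) (al k) (al0 k) (ma k) (ha k)).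
rewrite -mulr_sumr => h; have x2 : 0 < x ^+ 2 by exact: exprn_gt0.
apply: prob_leS (prob_le_markov x2 h) => u /= [j jr xj].
pose G h := \sum_(k < m) (a k u * U k h u - \int[P]_v (a k v * U k h v)).
have G0 : G 0%N = 0.
  rewrite /G big1 // => k _; rewrite excursion0 mulr0.
  under eq_Rintegral do rewrite excursion0 mulr0.
  by rewrite Rintegral_cst // mul0r subrr.
have := chain_increment_le G 0 jr; rewrite add0n G0 subr0 => Gj.
apply: lt_le_trans (_ : G j ^+ 2 <= _).
  rewrite -[ltRHS]real_normK ?num_real//.
  by rewrite ltr_sqr ?nnegrE ?normr_ge0 ?(ltW x0) //; exact: xj.
rewrite -ler_sqr ?nnegrE ?sqr_ge0 ?sqnorm4_ge0 // sqr_sqnorm4 // -exprM.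
apply: le_trans Gj _; rewrite le_eqVlt; apply/orP; left; apply/eqP.
apply: eq_bigr => i _; congr (_ * _ ^+ 4).
by rewrite /G -sumrB; apply: eq_bigr => k _; rewrite EZ ZE; ring.
Qed.

End maximal.

(** * Noise at one dyadic distance *)

Section levels.
Context d (T : measurableType d) (R : realType) (P : probability T R).
Variable Y : nat -> int -> {RV P >-> R}.
Hypothesis Yindep : independent_processes Y.
Hypothesis Ystat : forall k, centered_4th_order_stationary (Y k).
Local Notation S := (noise_sum Y).
Variables A K : R.
Hypothesis A0 : 0 <= A.
Hypothesis K0 : 0 <= K.
Hypothesis S4 : forall k a b,
  mean_le P (fun u => (S k b u - S k a u) ^+ 4) (A / 1000 * (b%:R - a%:R) ^+ 2).
Hypothesis Scov : forall k j a b,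
  `|\int[P]_u (S k j u * (S k b u - S k a u))| <= K * `|b%:R - a%:R|.

Lemma noise_sum_pow4 k j : mean_le P (fun u => S k j u ^+ 4) (A * j%:R ^+ 2).
Proof.
have := S4 k 0 j; rewrite subr0.
under eq_fun do rewrite noise_sum0 subr0.
apply: mean_leW; apply: ler_wpM2r; first exact: sqr_ge0.
have thousand : 0 < 1000 :> R by rewrite ltr0n.
by rewrite (ler_pdivrMr _ _ thousand); have := A0; lra.
Qed.

(** From f^2 <= x + f^4 / x. *)
Lemma mean_le_sqr (f : T -> R) (c x : R) : 0 < x -> measurable_fun setT f ->
  mean_le P (fun u => f u ^+ 4) (c * x ^+ 2) ->
  mean_le P (fun u => f u ^+ 2) ((1 + c) * x).
Proof.
move=> x0 mf h.
have hx : mean_le P (fun=> x) x.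
  apply: mean_leP; first exact: integ_cst.
    by move=> _; exact: ltW.
  by rewrite mean_cst.
have xi : 0 <= x^-1 by rewrite invr_ge0 ltW.
have := mean_leD hx (mean_leZ xi h).
have -> : x + x^-1 * (c * x ^+ 2) = (1 + c) * x by field; rewrite gt_eqF.
apply: mean_le_le; first exact: measurable_funX.
move=> u; rewrite sqr_ge0 /=.
have -> : f u ^+ 4 = (f u ^+ 2) ^+ 2 by rewrite -exprM.
move: (f u ^+ 2) (sqr_ge0 (f u)) => y y0.
have -> : x + x^-1 * y ^+ 2 = x^-1 * (x ^+ 2 + y ^+ 2) by field; rewrite gt_eqF.
rewrite ler_pdivlMl //; have := sqr_ge0 (x - y); nra.
Qed.

Variables (n j0 m : nat).
Hypothesis n0 : (0 < n)%N.
Hypothesis j0n : (j0 <= n)%N.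
Hypothesis m0 : (0 < m)%N.

(** The noise in the numerator of the gain at the change point itself. *)
Definition bridge k u : R := S k j0 u - j0%:R / n%:R * S k n u.
Local Notation N0 := bridge.

Let nr : 0 < n%:R :> R. Proof. by rewrite ltr0n. Qed.

Let ratio : 0 <= (j0%:R / n%:R : R) <= 1.
Proof. by rewrite divr_ge0 //= ler_pdivrMr // mul1r ler_nat. Qed.

Lemma adapted_bridge k : adapted (noise_events Y k) (N0 k).
Proof.
apply: measurable_funB; first exact: adapted_noise_sum.
apply: measurable_funM; first exact: measurable_cst.
exact: adapted_noise_sum.
Qed.

Lemma measurable_bridge k : measurable_fun setT (N0 k).
Proof.
exact: adapted_measurable (@noise_events_measurable _ _ _ P Y k)
  (@adapted_bridge k).
Qed.

Lemma bridge_pow4 k : mean_le P (fun u => N0 k u ^+ 4) (16 * A * n%:R ^+ 2).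
Proof.
have A0' := A0; have eight : 0 <= 8 :> R by exact: ler0n.
have h := mean_leZ eight (mean_leD (noise_sum_pow4 k j0) (noise_sum_pow4 k n)).
apply: mean_leW; last apply: (mean_le_le _ _ h).
- have : j0%:R ^+ 2 <= n%:R ^+ 2 :> R by rewrite ler_sqr ?nnegrE // ler_nat.
  by move=> /(ler_wpM2l A0); lra.
- by apply: measurable_funX; exact: measurable_bridge.
move=> u; rewrite exprn_even_ge0 //=.
apply: le_trans (pow4_sub_le _ _) _; apply: ler_wpM2l => //.
rewrite lerD2l exprMn ler_piMl ?exprn_even_ge0 //.
by rewrite exprn_ile1 //; case/andP: ratio.
Qed.

Let al : R := 4 * (1 + A) * n%:R.
Let al0 : 0 < al.
Proof. by have A0' := A0; rewrite mulr_gt0 // mulr_gt0 //; lra. Qed.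

Let bridge_al k : mean_le P (fun u => N0 k u ^+ 4) (al ^+ 2).
Proof.
apply: mean_leW (bridge_pow4 k); rewrite /al exprMn.
apply: ler_wpM2r; first exact: sqr_ge0.
by have := A0; nra.
Qed.

(** In the gain these terms carry a factor h / n^2 at every distance h at once, so
their mean, of order m n, is all that has to be known about them. *)
Lemma static_mean : mean_le P
  (fun u => \sum_(k < m) (N0 k u ^+ 2 + S k n u ^+ 2))
  (m%:R * (2 * (1 + 16 * A) * n%:R)).
Proof.
have h1 k := mean_le_sqr nr (@measurable_bridge k) (bridge_pow4 k).
have h2 k := mean_le_sqr nr (@measurable_noise_sum _ _ _ P Y k n) (noise_sum_pow4 k n).
have h := mean_le_sum (index_enum 'I_m) (fun k : 'I_m => mean_leD (h1 k) (h2 k)).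
apply: mean_leW h; rewrite sumr_const card_ord -[leLHS]mulr_natl.
apply: ler_wpM2l; first exact: ler0n.
by have := mulr_ge0 A0 (ltW nr); lra.
Qed.

Variables (delta : nat -> R) (theta : R).
Let D : R := \sum_(k < m) delta k ^+ 2.
Hypothesis D0 : 0 < D.
Hypothesis theta0 : 0 < theta.
Hypothesis snr1 : m%:R <= n%:R * D.
Hypothesis snr2 : 8 * (1 + A) * m%:R <= theta * (n%:R * D).
Hypothesis snr3 : 8 * K * m%:R <= theta * (n%:R * D).

Variable p : nat -> nat.
Hypothesis p_lip : forall h h', `|(p h)%:R - (p h')%:R| <= `|h%:R - h'%:R| :> R.
Local Notation U := (excursion Y p).

Let mr : 0 < m%:R :> R. Proof. by rewrite ltr0n. Qed.

Let integ_bridge k h : integ P (fun u => N0 k u * U k h u).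
Proof.
have h1 := integ_noise_sumM Ystat k j0 (p 0) (p h).
have h2 := integZ (j0%:R / n%:R) (integ_noise_sumM Ystat k n (p 0) (p h)).
apply: eq_integrable (integB h1 h2) => // u _ /=.
by rewrite /excursion /bridge; congr (_%:E); ring.
Qed.

Let mean_bridge k h : `|\int[P]_u (N0 k u * U k h u)| <= 2 * K * h%:R.
Proof.
have h1 := integ_noise_sumM Ystat k j0 (p 0) (p h).
have h2 := integ_noise_sumM Ystat k n (p 0) (p h).
have -> : \int[P]_u (N0 k u * U k h u) =
  \int[P]_u (S k j0 u * (S k (p h) u - S k (p 0) u)) -
  j0%:R / n%:R * \int[P]_u (S k n u * (S k (p h) u - S k (p 0) u)).
  rewrite -RintegralZl // -RintegralB //; last exact: integZ.
  by apply: eq_Rintegral => u _; rewrite /excursion /bridge; ring.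
have ph : `|(p h)%:R - (p 0)%:R| <= h%:R :> R.
  by apply: le_trans (p_lip h 0) _; rewrite subr0 ger0_norm.
have c1 := le_trans (Scov k j0 (p 0) (p h)) (ler_wpM2l K0 ph).
have c2 := le_trans (Scov k n (p 0) (p h)) (ler_wpM2l K0 ph).
apply: le_trans (ler_normB _ _) _; rewrite normrM.
have /andP[ra0 ra1] := ratio.
rewrite (ger0_norm ra0) -mulrA mulr2n mulrDl mul1r; apply: lerD => //.
by rewrite -[leRHS]mul1r; apply: ler_pM.
Qed.

(** What the noise must satisfy at distance h for the loss t of signal to
dominate, t being comparable to h D. *)
Definition small_excursion (t : R) u h :=
  [/\ \sum_(k < m) U k h u ^+ 2 <= theta * n%:R * t,
      `|\sum_(k < m) delta k * U k h u| <= theta * t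
    & `|\sum_(k < m) N0 k u * U k h u| <= theta * n%:R * t].

(** At distance about z = 2^r, Chebyshev's inequality compares standard deviations
of order (z D)^(1/2), (m n z)^(1/2) and m^(1/2) z with z D, n z D and n z D. The
last bound does not decrease in r, but it carries the factor m / (n D)^2, which
z D >= 1 turns into a summable one. *)
Lemma level_prob (r : nat) : 1 <= 2 ^+ r * D ->
  prob_le P
    [set u | exists2 h, (h <= 2 ^ r.+1)%N & ~ small_excursion (2 ^+ r * D) u h]
    (2000 * (1 + A) ^+ 2 / theta ^+ 2 *
      ((2 ^+ r * D)^-1 + m%:R / (n%:R * D) * (2 ^+ r / n%:R))).
Proof.
have A0' := A0; set z : R := 2 ^+ r => zD1.
have z0 : 0 < z by exact: exprn_gt0.
have zD : 0 < z * D by exact: mulr_gt0.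
have nD : 0 < n%:R * D by exact: mulr_gt0.
have zS : (2 : R) ^+ r.+1 = 2 * z by rewrite exprS.
have th2 : 0 < theta ^+ 2 by exact: exprn_gt0.
have x1 : 0 < theta * n%:R * (z * D) by rewrite !mulr_gt0.
have x2 : 0 < theta * (z * D) by rewrite mulr_gt0.
have x3 : 0 < theta * n%:R * (z * D) / 2 by rewrite divr_gt0.
have zmul c : c * m%:R <= theta * (n%:R * D) ->
    c * (m%:R * z) <= theta * n%:R * (z * D).
  by move=> /(ler_wpM2r (ltW z0)); lra.
have B1 := @excursion_norm_prob _ _ _ _ _ Yindep A p p_lip A0 S4 r.+1 m
  (theta * n%:R * (z * D)).
have {}B1 := B1 _ x1.
have B2 := @excursion_lin_prob _ _ _ _ _ Yindep A p p_lip A0 S4 r.+1 m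
  (fun k _ => delta k) (fun k => delta k ^+ 2 + D / m%:R) (theta * (z * D)).
have B3 := @excursion_lin_prob _ _ _ _ _ Yindep A p p_lip A0 S4 r.+1 m
  N0 (fun=> al) (theta * n%:R * (z * D) / 2) adapted_bridge
  (fun=> al0) bridge_al integ_bridge x3.
have iU k h : integ P (U k h).
  by apply: integB; exact: integ_noise_sum.
have {}B1 := B1 _; have {}B2 := B2 _ _ _ _ x2.
have {}B1 : prob_le P [set u | exists2 h, (h <= 2 ^ r.+1)%N &
     theta * n%:R * (z * D) < \sum_(k < m) U k h u ^+ 2]
     (168 * A * (m%:R * (2 * z) ^+ 2) / (theta * n%:R * (z * D)) ^+ 2).
  rewrite -zS; apply: B1; rewrite zS.
  by have := zmul _ snr2; lra.
have {}B2 : prob_le P [set u | exists2 h, (h <= 2 ^ r.+1)%N &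
     theta * (z * D) < `|\sum_(k < m) delta k * U k h u|]
     (42 * ((1 + A) * (2 * z) * (2 * D)) / (theta * (z * D)) ^+ 2).
  have -> : 2 * D = \sum_(k < m) (delta k ^+ 2 + D / m%:R).
    rewrite big_split /= sumr_const card_ord -/D -[in RHS]mulr_natr.
    by field; rewrite gt_eqF.
  rewrite -zS; apply: (prob_leS _ (B2 _ _ _ _)).
  - move=> u /= [h hr hu]; exists h => //.
    apply: lt_le_trans hu _; rewrite le_eqVlt; apply/orP; left; apply/eqP.
    congr (`|_|); apply: eq_bigr => k _.
    rewrite RintegralZl //; last exact: iU.
    have -> : \int[P]_v U k h v = 0.
      rewrite /excursion RintegralB //; try exact: integ_noise_sum.
      by rewrite !mean_noise_sum // subrr.
    by rewrite mulr0 subr0.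
  - by move=> k; exact: measurable_cst.
  - move=> k; apply: ltr_wpDl; first exact: sqr_ge0.
    exact: divr_gt0.
  - move=> k; apply: mean_leP; first exact: integ_cst.
      by move=> _; exact: exprn_even_ge0.
    rewrite (mean_cst P (delta k ^+ 4)).
    have -> : delta k ^+ 4 = (delta k ^+ 2) ^+ 2 by rewrite -exprM.
    rewrite ler_sqr ?nnegrE ?sqr_ge0 //.
      by rewrite lerDl ltW // divr_gt0.
    by rewrite addr_ge0 ?sqr_ge0 // ltW // divr_gt0.
  - by move=> k h; exact: integZ.
have {}B3 : prob_le P [set u | exists2 h, (h <= 2 ^ r.+1)%N &
     theta * n%:R * (z * D) < `|\sum_(k < m) N0 k u * U k h u|]
     (42 * ((1 + A) * (2 * z) * (m%:R * al)) / (theta * n%:R * (z * D) / 2) ^+ 2).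
  have -> : m%:R * al = \sum_(k < m) al.
    by rewrite sumr_const card_ord mulr_natl.
  rewrite -zS; apply: (prob_leS _ B3) => u /= [h hr hu]; exists h => //.
  rewrite sumrB.
  have hm : `|\sum_(k < m) \int[P]_v (N0 k v * U k h v)| <=
      theta * n%:R * (z * D) / 2.
    apply: le_trans (ler_norm_sum _ _ _) _.
    apply: (@le_trans _ _ (\sum_(k < m) 2 * K * h%:R)).
      by apply: ler_sum => k _; exact: mean_bridge.
    rewrite sumr_const card_ord -[leLHS]mulr_natr.
    have hz : h%:R <= 2 * z :> R.
      by rewrite -zS -natrX ler_nat.
    have := ler_wpM2l K0 hz => /(ler_wpM2r (ltW mr)).
    by have := zmul _ snr3; lra.
  have := ler_normD (\sum_(k < m) N0 k u * U k h u -
     \sum_(k < m) \int[P]_v (N0 k v * U k h v))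
     (\sum_(k < m) \int[P]_v (N0 k v * U k h v)).
  by rewrite subrK; lra.
have B := prob_leU B1 (prob_leU B2 B3).
apply: prob_leS (prob_leW _ B).
  move=> u /= [h hr hu].
  have [c1|c1] := ltP (theta * n%:R * (z * D)) (\sum_(k < m) U k h u ^+ 2).
    by left; exists h.
  right.
  have [c2|c2] := ltP (theta * (z * D)) `|\sum_(k < m) delta k * U k h u|.
    by left; exists h.
  right.
  have [c3|c3] := ltP (theta * n%:R * (z * D)) `|\sum_(k < m) N0 k u * U k h u|.
    by exists h.
  by case: hu.
have rho0 : 0 <= m%:R / (n%:R * D) by rewrite divr_ge0 ?ltW.
have rho1 : m%:R / (n%:R * D) <= 1 by rewrite ler_pdivrMr // mul1r.
have A1 : 1 <= (1 + A) ^+ 2 by rewrite exprn_ege1 //; lra.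
have A2 : 1 + A <= (1 + A) ^+ 2 by rewrite expr2 ler_peMl //; lra.
have E1 : 168 * A * (m%:R * (2 * z) ^+ 2) / (theta * n%:R * (z * D)) ^+ 2 <=
   672 * (1 + A) ^+ 2 / theta ^+ 2 * (m%:R / (n%:R * D) * (z / n%:R)).
  have -> : 168 * A * (m%:R * (2 * z) ^+ 2) / (theta * n%:R * (z * D)) ^+ 2 =
    (A / theta ^+ 2 * (m%:R / (n%:R * D)) / n%:R) * (672 * D^-1).
    by field; rewrite !gt_eqF.
  have -> : 672 * (1 + A) ^+ 2 / theta ^+ 2 * (m%:R / (n%:R * D) * (z / n%:R)) =
    ((1 + A) ^+ 2 / theta ^+ 2 * (m%:R / (n%:R * D)) / n%:R) * (672 * z).
    by field; rewrite !gt_eqF.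
  apply: ler_pM.
  - by rewrite !(mulr_ge0, invr_ge0) // ltW.
  - by apply: mulr_ge0; [exact: ler0n | rewrite invr_ge0 ltW].
  - apply: ler_wpM2r; first by rewrite invr_ge0 ltW.
    apply: ler_wpM2r => //; apply: ler_wpM2r; first by rewrite invr_ge0 ltW.
    by lra.
  - apply: ler_wpM2l; first exact: ler0n.
    by rewrite -div1r ler_pdivrMr.
have E2 : 42 * ((1 + A) * (2 * z) * (2 * D)) / (theta * (z * D)) ^+ 2 <=
   168 * (1 + A) ^+ 2 / theta ^+ 2 * (z * D)^-1.
  have -> : 42 * ((1 + A) * (2 * z) * (2 * D)) / (theta * (z * D)) ^+ 2 =
     168 * (1 + A) / theta ^+ 2 * (z * D)^-1 by field; rewrite !gt_eqF.
  apply: ler_wpM2r; first by rewrite invr_ge0 ltW.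
  apply: ler_wpM2r; first by rewrite invr_ge0 ltW.
  exact: (ler_wpM2l (ler0n R 168) A2).
have E3 : 42 * ((1 + A) * (2 * z) * (m%:R * al)) /
     (theta * n%:R * (z * D) / 2) ^+ 2 <=
   1344 * (1 + A) ^+ 2 / theta ^+ 2 * (z * D)^-1.
  have -> : 42 * ((1 + A) * (2 * z) * (m%:R * al)) /
     (theta * n%:R * (z * D) / 2) ^+ 2 =
     1344 * (1 + A) ^+ 2 / theta ^+ 2 * (z * D)^-1 * (m%:R / (n%:R * D)).
    by rewrite /al; field; rewrite !gt_eqF.
  have t0 : 0 <= (theta ^+ 2)^-1 by rewrite invr_ge0 ltW.
  have t1 : 0 <= (z * D)^-1 by rewrite invr_ge0 ltW.
  have t2 := mulr_ge0 (mulr_ge0 (mulr_ge0 (ler0n R 1344) (sqr_ge0 (1 + A))) t0) t1.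
  by have := ler_wpM2l t2 rho1; rewrite mulr1.
have q0 : 0 <= (1 + A) ^+ 2 / theta ^+ 2 by rewrite divr_ge0 ?sqr_ge0.
have q1 : 0 <= (1 + A) ^+ 2 / theta ^+ 2 * (z * D)^-1.
  by rewrite mulr_ge0 // invr_ge0 ltW.
have q2 : 0 <= (1 + A) ^+ 2 / theta ^+ 2 * (m%:R / (n%:R * D) * (z / n%:R)).
  by rewrite mulr_ge0 // mulr_ge0 // divr_ge0 // ltW.
rewrite mulrDr.
move: E1 E2 E3 q1 q2; rewrite -!(mulrA _ ((1 + A) ^+ 2)).
rewrite -!(mulrA _ ((1 + A) ^+ 2 / theta ^+ 2)).
set X1 := (1 + A) ^+ 2 / theta ^+ 2 * (z * D)^-1.
set X2 := (1 + A) ^+ 2 / theta ^+ 2 * (_ * _).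
set L1 := _ / _; set L2 := _ / _; set L3 := _ / _.
lra.
Qed.

End levels.

(** * The gain away from the change point *)

Section gain_analysis.
Context {R : realType}.

(** Here x and y are the distances of the split point from the two ends of the
sample and x0 and y0 those of the change point. Exchanging the two ends treats
a split on the other side. *)
Lemma gain_weights (c N x y x0 y0 : R) :
  0 < c -> 0 < N -> x + y = N -> x0 + y0 = N ->
  c * N < x -> c * N < y -> c * N < x0 -> c * N < y0 -> x0 <= x ->
  let h := x - x0 in let rho := x0 / x in
  let a := x^-1 + y^-1 in let a0 := x0^-1 + y0^-1 in
  let s := x0 * y / N in let s0 := x0 * y0 / N in
  [/\ a * s = rho, a0 * s0 = 1, a0 * s0 ^+ 2 - a * s ^+ 2 = h * rho,
      c <= rho <= 1 & 1 - rho <= h / (c * N)] /\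
  (0 <= a <= 2 / (c * N) /\ `|a - a0| <= 2 * h / (c * N) ^+ 2).
Proof.
move=> c0 N0 xy xy0 cx cy cx0 cy0 x0x h rho a a0 s s0.
have cN : 0 < c * N by rewrite mulr_gt0.
have xp : 0 < x by exact: lt_trans cx.
have yp : 0 < y by exact: lt_trans cy.
have x0p : 0 < x0 by exact: lt_trans cx0.
have y0p : 0 < y0 by exact: lt_trans cy0.
have xy_n : x + y != 0 by rewrite xy gt_eqF.
have xy0_n : x0 + y0 != 0 by rewrite xy0 gt_eqF.
have h0 : 0 <= h by rewrite subr_ge0.
have inv_le (v : R) : c * N < v -> v^-1 <= (c * N)^-1.
  by move=> cv; rewrite lef_pV2 ?posrE ?ltW // (lt_trans cN).
have inv_ge (v : R) : 0 < v -> 0 <= v^-1 by move=> ?; rewrite invr_ge0 ltW.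
have as_ : a * s = rho.
  by rewrite /a /s /rho -xy; field; rewrite xy_n !gt_eqF.
have as0 : a0 * s0 = 1.
  by rewrite /a0 /s0 -xy0; field; rewrite xy0_n !gt_eqF.
split; split => //.
- have -> : a0 * s0 ^+ 2 = s0 by rewrite expr2 mulrA as0 mul1r.
  have -> : a * s ^+ 2 = rho * s by rewrite expr2 mulrA as_.
  rewrite /s0 /s /rho /h.
  have -> : y = N - x by rewrite -xy addrC addKr.
  have -> : y0 = N - x0 by rewrite -xy0 addrC addKr.
  by field; rewrite !gt_eqF.
- apply/andP; split; last by rewrite ler_pdivrMr // mul1r.
  rewrite ler_pdivlMr //; apply: le_trans (ltW cx0).
  by rewrite ler_wpM2l ?ltW // -xy ltrDl.
- have -> : 1 - rho = h * x^-1 by rewrite /rho /h; field; rewrite gt_eqF.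
  by apply: ler_wpM2l => //; exact: inv_le.
- rewrite addr_ge0 ?inv_ge //=.
  by have := inv_le x cx; have := inv_le y cy; rewrite /a; lra.
have yy0 : y0 - y = h by rewrite /h; lra.
have -> : a - a0 = h * (y^-1 * y0^-1) - h * (x^-1 * x0^-1).
  have -> : h * (y^-1 * y0^-1) = y^-1 - y0^-1.
    by rewrite -yy0; field; rewrite !gt_eqF.
  have -> : h * (x^-1 * x0^-1) = x0^-1 - x^-1.
    by rewrite /h; field; rewrite !gt_eqF.
  by rewrite /a /a0; ring.
have sq (v v0 : R) : c * N < v -> c * N < v0 ->
    `|h * (v^-1 * v0^-1)| <= h / (c * N) ^+ 2.
  move=> cv cv0; have vp : 0 < v by exact: lt_trans cv.
  have v0p : 0 < v0 by exact: lt_trans cv0.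
  rewrite ger0_norm; last by rewrite !mulr_ge0 ?inv_ge.
  apply: ler_wpM2l => //; rewrite expr2 invfM.
  by apply: ler_pM; rewrite ?inv_ge ?inv_le.
apply: le_trans (ler_normB _ _) _.
by have := sq y y0 cy cy0; have := sq x x0 cx cx0; lra.
Qed.

Lemma psum_signal (n j0 j : nat) (mu1 mu2 : R) (x y : nat -> R) :
  (forall t, (1 <= t <= n)%N ->
     x t = mu1 * (t <= j0)%N%:R + mu2 * (j0 < t)%N%:R + y t) ->
  (j <= n)%N ->
  psum x j = (minn j j0)%:R * mu1 + (j - minn j j0)%:R * mu2 + psum y j.
Proof.
move=> hx; elim: j => [|j IH] jn.
  by rewrite /psum !big_geq // min0n mul0r mul0r !add0r.
have psumS (f : nat -> R) : psum f j.+1 = psum f j + f j.+1.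
  by rewrite /psum big_nat_recr.
rewrite !psumS IH ?(ltnW jn) //.
rewrite hx ?jn //.
have [jj|jj] : (j < j0)%N \/ (j0 <= j)%N by lia.
  have -> : (j0 < j.+1)%N = false by lia.
  have -> : minn j.+1 j0 = (minn j j0 + 1)%N by lia.
  have -> : (j.+1 - (minn j j0 + 1) = j - minn j j0)%N by lia.
  by rewrite jj natrD /=; ring.
have -> : (j < j0)%N = false by lia.
have -> : minn j.+1 j0 = minn j j0 by lia.
have -> : (j.+1 - minn j j0 = (j - minn j j0) + 1)%N by lia.
by rewrite ltnS jj natrD /=; ring.
Qed.

Lemma gain_signal (n j0 j : nat) (mu1 mu2 : R) (x y : nat -> R) :
  (forall t, (1 <= t <= n)%N ->
     x t = mu1 * (t <= j0)%N%:R + mu2 * (j0 < t)%N%:R + y t) ->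
  (0 < n)%N -> (j <= n)%N -> (j0 <= n)%N ->
  gain n x j = (j%:R^-1 + (n - j)%:R^-1) *
    (((minn j j0)%:R - j%:R * j0%:R / n%:R) * (mu1 - mu2)
     + (psum y j - j%:R / n%:R * psum y n)) ^+ 2.
Proof.
move=> hx n0 jn j0n; rewrite /gain; congr (_ * _ ^+ 2).
rewrite (psum_signal hx jn) (psum_signal hx (leqnn n)).
have -> : minn n j0 = j0 by lia.
rewrite !natrB //; last by lia.
by field; rewrite pnatr_eq0 -lt0n.
Qed.

End gain_analysis.

Section geometric.
Context {R : realType}.

Lemma geometric_tail (x : R) (N : nat) : 0 < x ->
  \sum_(r <- iota 0 N | x < 2 ^+ r) (2 ^+ r)^-1 <= 2 / x.
Proof.
have all2 M : \sum_(r <- iota 0 M) ((2 : R) ^+ r)^-1 <= 2 - (2 ^+ M)^-1 * 2.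
  elim: M => [|M IH]; first by rewrite big_nil expr0 invr1; lra.
  rewrite -[M.+1]addn1 iotaD big_cat big_seq1 add0n /=.
  rewrite addn1 exprS invfM.
  have : (0 : R) <= (2 ^+ M)^-1 by rewrite invr_ge0 exprn_ge0.
  by lra.
elim: N x => [|N IH] x x0; first by rewrite big_nil divr_ge0 // ltW.
have [x1|x1] := ltP x 1.
  apply: (@le_trans _ _ (\sum_(r <- iota 0 N.+1) ((2 : R) ^+ r)^-1)).
    rewrite big_mkcond; apply: ler_sum => r _; case: ifP => _ //.
  apply: le_trans (all2 _) _.
  have : (0 : R) <= (2 ^+ N.+1)^-1 by rewrite invr_ge0 exprn_ge0.
  have : 2 <= 2 / x by rewrite ler_pdivlMr //; lra.
  by lra.
rewrite /= big_cons expr0 ltNge x1 /=.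
rewrite -[1%N]addn0 iotaDl big_map.
have x2 : 0 < x / 2 by rewrite divr_gt0.
have -> : 2 / x = 2^-1 * (2 / (x / 2)) by field; rewrite gt_eqF.
have half0 : 0 <= 2^-1 :> R by rewrite invr_ge0.
apply: le_trans (ler_wpM2l half0 (IH _ x2)).
rewrite mulr_sumr le_eqVlt; apply/orP; left; apply/eqP.
apply: eq_big => r; last by rewrite add1n exprS invfM.
by rewrite add1n exprS ltr_pdivrMr // mulrC.
Qed.

Lemma geometric_head (N : nat) : \sum_(r <- iota 0 N) (2 : R) ^+ r <= 2 ^+ N.
Proof.
suff -> : \sum_(r <- iota 0 N) (2 : R) ^+ r = 2 ^+ N - 1 by lra.
elim: N => [|N IH]; first by rewrite big_nil expr0 subrr.
by rewrite -[N.+1]addn1 iotaD big_cat big_seq1 add0n IH /= addn1 exprS; ring.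
Qed.

End geometric.

(** * Tail bound for the estimation error *)

Lemma subn_lipschitz (a b b' : nat) : (a - b - (a - b') <= b' - b)%N.
Proof. lia. Qed.

Section panel.
Context d (T : measurableType d) (R : realType) (P : probability T R).
Variable Y : nat -> int -> {RV P >-> R}.
Local Notation S := (noise_sum Y).

Variables (n j0 m : nat) (c : R) (mu1 mu2 : 'I_m -> R) (delta : nat -> R).
Hypothesis n0 : (0 < n)%N.
Hypothesis c0 : 0 < c.
Hypothesis j0_gt : c * n%:R < j0%:R.
Hypothesis j0_lt : c * n%:R < n%:R - j0%:R.
Hypothesis deltaE : forall k : 'I_m, delta k = mu1 k - mu2 k.
Let D : R := \sum_(k < m) delta k ^+ 2.
Hypothesis D0 : 0 < D.
Let theta : R := c ^+ 3 / 32.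

Definition panel_obs (w : T) (k : 'I_m) (t : nat) : R :=
  mu1 k * (t <= j0)%N%:R + mu2 k * (j0 < t)%N%:R + Y k t w.

Let nr : 0 < n%:R :> R. Proof. by rewrite ltr0n. Qed.
Let j0n : (j0 <= n)%N.
Proof.
rewrite -(ler_nat R) -subr_ge0; apply/ltW.
by apply: lt_trans j0_lt; rewrite mulr_gt0.
Qed.

(** The walk p reaches the split point j after h steps from the change point; the
two sides of the change point differ only in the sign of j - j0. *)
Lemma far_split_gain_lt (p : nat -> nat) (h j : nat) (t : R) (w : T)
    (x : 'I_m -> nat -> R) :
  (forall k u, (1 <= u <= n)%N -> x k u = panel_obs w k u) ->
  p 0 = j0 -> p h = j -> (0 < h)%N -> `|j%:R - j0%:R| = h%:R :> R ->
  c * n%:R < j%:R -> c * n%:R < n%:R - j%:R ->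
  t <= h%:R * D -> small_excursion Y n j0 m delta theta p t w h ->
  \sum_(k < m) (bridge Y n j0 k w ^+ 2 + S k n w ^+ 2) <=
    theta ^+ 2 * n%:R ^+ 2 * D ->
  \sum_(k < m) gain n (x k) j < \sum_(k < m) gain n (x k) j0.
Proof.
move=> xE p0 ph h0 jh j_gt j_lt tD [sU sd sN] static.
have cn : 0 < c * n%:R by rewrite mulr_gt0.
have jn : (j <= n)%N.
  by rewrite -(ler_nat R) -subr_ge0 ltW // (lt_trans cn).
have c1 : c <= 1.
  rewrite -(ler_pM2r nr) mul1r; have := ltW j0_gt; have : j0%:R <= n%:R :> R.
    by rewrite ler_nat.
  by lra.
have th0 : 0 < theta by rewrite divr_gt0 // exprn_gt0.
have hr : 0 < h%:R :> R by rewrite ltr0n.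
have gE k i : (i <= n)%N -> gain n (x k) i =
    (i%:R^-1 + (n - i)%:R^-1) *
    (((minn i j0)%:R - i%:R * j0%:R / n%:R) * delta k
     + (S k i w - i%:R / n%:R * S k n w)) ^+ 2.
  move=> iN; rewrite deltaE.
  by apply: (gain_signal (y := fun t => Y k t w) (xE k) n0 iN j0n).
pose a (i : nat) : R := i%:R^-1 + (n - i)%:R^-1.
pose s (i : nat) : R := (minn i j0)%:R - i%:R * j0%:R / n%:R.
have weights : exists rho : R,
   [/\ a j * s j = rho, a j0 * s j0 = 1,
       a j0 * s j0 ^+ 2 - a j * s j ^+ 2 = h%:R * rho,
      c <= rho <= 1 & 1 - rho <= h%:R / (c * n%:R)] /\
  (0 <= a j <= 2 / (c * n%:R) /\ `|a j - a j0| <= 2 * h%:R / (c * n%:R) ^+ 2).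
  have ni (i : nat) : (i <= n)%N -> (n - i)%:R = n%:R - i%:R :> R.
    by move=> ?; rewrite natrB.
  have s0E : s j0 = j0%:R * (n%:R - j0%:R) / n%:R.
    by rewrite /s minnn; field; rewrite gt_eqF.
  have [jj|jj] := leqP j0 j.
    have jjr : j0%:R <= j%:R :> R by rewrite ler_nat.
    have sE : s j = j0%:R * (n%:R - j%:R) / n%:R.
      by rewrite /s (minn_idPr jj); field; rewrite gt_eqF.
    have hE : j%:R - j0%:R = h%:R :> R by rewrite -jh ger0_norm ?subr_ge0.
    have := @gain_weights R c n%:R j%:R (n%:R - j%:R) j0%:R (n%:R - j0%:R)
       c0 nr (subrKC _ _) (subrKC _ _) j_gt j_lt j0_gt j0_lt jjr.
    rewrite /= -s0E -sE hE /a !ni // => hw.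
    by exists (j0%:R / j%:R).
  have jjr : n%:R - j0%:R <= n%:R - j%:R :> R by rewrite lerD2l lerN2 ler_nat ltnW.
  have sE : s j = (n%:R - j0%:R) * j%:R / n%:R.
    by rewrite /s (minn_idPl (ltnW jj)); field; rewrite gt_eqF.
  have hE : n%:R - j%:R - (n%:R - j0%:R) = h%:R :> R.
    by rewrite -jh distrC ger0_norm ?subr_ge0 ?ler_nat 1?ltnW //; ring.
  have := @gain_weights R c n%:R (n%:R - j%:R) j%:R (n%:R - j0%:R) j0%:R
     c0 nr (subrK _ _) (subrK _ _) j_lt j_gt j0_lt j0_gt jjr.
  rewrite /= -sE hE [(n%:R - j0%:R) * j0%:R]mulrC -s0E.
  rewrite [(n%:R - j%:R)^-1 + _]addrC [(n%:R - j0%:R)^-1 + _]addrC /a !ni // => hw.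
  by exists ((n%:R - j0%:R) / (n%:R - j%:R)).
case: weights => rho [[w1 w2 w3 w4 w5] [w6 w7]].
have hn : 0 < (h%:R : R) <= n%:R.
  rewrite hr -jh ler_norml; have := jn; have := j0n.
  by rewrite -!(ler_nat R); have := ler0n R j; have := ler0n R j0; lra.
pose g : R := (j%:R - j0%:R) / n%:R.
have gh : `|g| = h%:R / n%:R by rewrite normrM jh gtr0_norm // invr_gt0.
have c01 : 0 < c <= 1 by rewrite c0.
have tD' : 0 <= h%:R * D - t by rewrite subr_ge0.
have b1 : \sum_(k < m) excursion Y p k h w ^+ 2 <= theta * n%:R * (h%:R * D).
  by apply: le_trans sU _; rewrite ler_wpM2l // mulr_ge0 // ltW.
have b2 : `|\sum_(k < m) delta k * excursion Y p k h w| <= theta * (h%:R * D).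
  by apply: le_trans sd _; rewrite ler_wpM2l // ltW.
have b3 : `|\sum_(k < m) bridge Y n j0 k w * excursion Y p k h w| <=
    theta * n%:R * (h%:R * D).
  by apply: le_trans sN _; rewrite ler_wpM2l // mulr_ge0 // ltW.
have main := @gain_drop R m (fun k => delta k) (fun k => bridge Y n j0 k w)
  (fun k => excursion Y p k h w) (fun k => S k n w) n%:R h%:R c theta rho
  (a j) (a j0) (s j) (s j0) g nr hn D0 c01 erefl w1 w2 w3 w4 w5 w6 w7 gh
  static b1 b2 b3.
congr (_ < _): main.
  apply: eq_bigr => k _; rewrite gE // -/(a j) -/(s j); congr (_ * (_ + _) ^+ 2).
  by rewrite /bridge /excursion ph p0 /g; field; rewrite gt_eqF.
by apply: eq_bigr => k _; rewrite gE.
Qed.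

Hypothesis m0 : (0 < m)%N.
Hypothesis Yindep : independent_processes Y.
Hypothesis Ystat : forall k, centered_4th_order_stationary (Y k).
Variables A K : R.
Hypothesis A0 : 0 <= A.
Hypothesis K0 : 0 <= K.
Hypothesis S4 : forall k a b,
  mean_le P (fun u => (S k b u - S k a u) ^+ 4) (A / 1000 * (b%:R - a%:R) ^+ 2).
Hypothesis Scov : forall k j a b,
  `|\int[P]_u (S k j u * (S k b u - S k a u))| <= K * `|b%:R - a%:R|.
Hypothesis snr1 : m%:R <= n%:R * D.
Hypothesis snr2 : 8 * (1 + A) * m%:R <= theta * (n%:R * D).
Hypothesis snr3 : 8 * K * m%:R <= theta * (n%:R * D).

Let theta0 : 0 < theta. Proof. by rewrite divr_gt0 // exprn_gt0. Qed.

Definition level_const : R := 2000 * (1 + A) ^+ 2 / theta ^+ 2.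

Lemma level_const_ge0 : 0 <= level_const.
Proof.
exact: divr_ge0 (mulr_ge0 (ler0n R 2000) (sqr_ge0 _)) (sqr_ge0 _).
Qed.

Variable K1 : R.
Hypothesis K1_ge2 : 2 <= K1.

(** The dyadic distances with 2^(r+1) D > K1, to which a split point at distance h
with h D > K1 belongs for r the logarithm of h. *)
Definition far_levels : seq nat :=
  [seq r <- iota 0 (trunc_log 2 n).+1 | K1 < 2 ^+ r.+1 * D].

(** The first part of the bound at one level decreases geometrically from the
smallest level on, the second increases geometrically up to the largest. *)
Lemma far_levels_prob (p : nat -> nat) :
  (forall h h', `|(p h)%:R - (p h')%:R| <= `|h%:R - h'%:R| :> R) ->
  prob_le P [set w | exists2 r, r \in far_levels &
     exists2 h, (h <= 2 ^ r.+1)%N &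
       ~ small_excursion Y n j0 m delta theta p (2 ^+ r * D) w h]
    (level_const * (4 / K1 + 2 * (m%:R / (n%:R * D)))).
Proof.
move=> p_lip.
have K1p : 0 < K1 by apply: lt_le_trans K1_ge2; rewrite ltr0n.
have h r : r \in far_levels -> prob_le P
    [set w | exists2 h, (h <= 2 ^ r.+1)%N &
       ~ small_excursion Y n j0 m delta theta p (2 ^+ r * D) w h]
    (level_const * ((2 ^+ r * D)^-1 + m%:R / (n%:R * D) * (2 ^+ r / n%:R))).
  rewrite mem_filter => /andP[hr _].
  have rD : 1 <= 2 ^+ r * D by move: hr; rewrite exprS; have := K1_ge2; lra.
  have H := level_prob Yindep Ystat A0 K0 S4 Scov n0 j0n m0 D0 theta0 snr1 snr2
    snr3 p_lip.
  exact: H rD.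
apply: prob_leW (prob_le_bigU h).
rewrite -mulr_sumr; apply: (ler_wpM2l level_const_ge0).
rewrite big_split /=; apply: lerD.
  have x0 : 0 < K1 / (2 * D) by rewrite divr_gt0 // mulr_gt0.
  have -> : 4 / K1 = 2 / (K1 / (2 * D)) * D^-1 by field; rewrite !gt_eqF.
  have Di : 0 <= D^-1 by rewrite invr_ge0 ltW.
  apply: le_trans (ler_wpM2r Di (geometric_tail (trunc_log 2 n).+1 x0)).
  rewrite mulr_suml /far_levels big_filter le_eqVlt; apply/orP; left; apply/eqP.
  apply: eq_big => r; last by rewrite invfM.
  by rewrite exprS ltr_pdivrMr ?mulr_gt0 //; congr (_ < _); ring.
rewrite -mulr_sumr [leRHS]mulrC; apply: ler_wpM2l.
  by rewrite divr_ge0 // ltW // mulr_gt0.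
rewrite -mulr_suml ler_pdivrMr //.
apply: (@le_trans _ _ (\sum_(r <- iota 0 (trunc_log 2 n).+1) (2 : R) ^+ r)).
  rewrite /far_levels big_filter big_mkcond; apply: ler_sum => r _.
  by case: ifP => // _; exact: exprn_ge0.
apply: le_trans (geometric_head _) _; rewrite exprS; apply: ler_wpM2l => //.
by rewrite -natrX ler_nat trunc_logP.
Qed.

(** Outside the exceptional events every far split point has a smaller gain than
the change point, so it cannot be the estimator. *)
Lemma lse_error_prob (x : T -> 'I_m -> nat -> R) (that : T -> R) :
  (forall w k u, (1 <= u <= n)%N -> x w k u = panel_obs w k u) ->
  (forall w, is_lse c n (x w) (that w)) ->
  prob_le P [set w | K1 < `|n%:R * D * (that w - j0%:R / n%:R)|]
    (2 * (1 + 16 * A) / theta ^+ 2 * (m%:R / (n%:R * D))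
     + 2 * (level_const * (4 / K1 + 2 * (m%:R / (n%:R * D))))).
Proof.
move=> xE hlse.
have K1p : 0 < K1 by apply: lt_le_trans K1_ge2; rewrite ltr0n.
pose pr (h : nat) := (j0 + h)%N; pose pl (h : nat) := (j0 - h)%N.
have pr_lip h h' : `|(pr h)%:R - (pr h')%:R| <= `|h%:R - h'%:R| :> R.
  rewrite /pr !natrD.
  by have -> : j0%:R + h%:R - (j0%:R + h'%:R) = h%:R - h'%:R :> R by ring.
have pl_lip h h' : `|(pl h)%:R - (pl h')%:R| <= `|h%:R - h'%:R| :> R.
  wlog hh : h h' / (h <= h')%N.
    move=> H; case: (leqP h h') => [/H //|/ltnW /H].
    by rewrite distrC [X in _ <= X]distrC.
  rewrite /pl [leRHS]distrC -!natrB ?leq_sub2l //.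
  by rewrite !ger0_norm ?ler0n // ler_nat; exact: subn_lipschitz.
have st0 : 0 < theta ^+ 2 * n%:R ^+ 2 * D by rewrite !mulr_gt0 // exprn_gt0.
have Bs := prob_le_markov st0
  (static_mean A0 S4 m n0 j0n).
have Br := far_levels_prob pr_lip.
have Bl := far_levels_prob pl_lip.
have := prob_leU Bs (prob_leU Br Bl).
have -> : m%:R * (2 * (1 + 16 * A) * n%:R) / (theta ^+ 2 * n%:R ^+ 2 * D) =
   2 * (1 + 16 * A) / theta ^+ 2 * (m%:R / (n%:R * D)).
  by field; rewrite !gt_eqF.
move=> bad; set b := level_const * _ in bad *.
have -> : 2 * b = b + b by ring.
apply: prob_leS bad => w /= hw.
have j0p : (0 < j0 <= n)%N.
  by rewrite j0n andbT -(ltr_nat R); apply: lt_trans j0_gt; rewrite mulr_gt0.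
have j0c : c < j0%:R / n%:R < 1 - c.
  rewrite ltr_pdivlMr // ltr_pdivrMr // j0_gt mulrBl mul1r.
  by have := j0_lt; lra.
have [j [/andP[j_gt0 jn] thatE jc gain_le]] := lse_max_gain c0 (hlse w) j0p j0c.
have [j_gt j_lt] : c * n%:R < j%:R /\ c * n%:R < n%:R - j%:R.
  by move: jc; rewrite ltr_pdivlMr // ltr_pdivrMr // mulrBl mul1r => /andP[]; lra.
have [|static] := ltP (theta ^+ 2 * n%:R ^+ 2 * D)
  (\sum_(k < m) (bridge Y n j0 k w ^+ 2 + S k n w ^+ 2)); first by left.
right.
have {}hw : K1 < D * `|j%:R - j0%:R|.
  have E : n%:R * D * (that w - j0%:R / n%:R) = D * (j%:R - j0%:R).
    by rewrite thatE; field; rewrite gt_eqF.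
  by move: hw; rewrite E normrM gtr0_norm.
have key p h : p 0 = j0 -> p h = j -> `|j%:R - j0%:R| = h%:R :> R ->
    exists2 r, r \in far_levels & exists2 h, (h <= 2 ^ r.+1)%N &
       ~ small_excursion Y n j0 m delta theta p (2 ^+ r * D) w h.
  move=> p0 ph jh; rewrite jh in hw.
  have h0 : (0 < h)%N.
    by rewrite lt0n; apply: contraTneq hw => ->; rewrite mulr0 -leNgt ltW.
  have hn : (h <= n)%N.
    rewrite -(ler_nat R) -jh ler_norml; have := j_lt; have := j0_lt.
    have := ler0n R j; have := ler0n R j0; have := mulr_gt0 c0 nr; lra.
  have /andP[rh hr] := trunc_log_bounds (isT : (1 < 2)%N) h0.
  exists (trunc_log 2 h).
    rewrite mem_filter mem_iota add0n ltnS leq_trunc_log //= andbT.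
    apply: lt_trans hw _; rewrite mulrC ltr_pM2r // -natrX ltr_nat.
    exact: hr.
  exists h; first exact: ltnW.
  move=> small.
  have tD : 2 ^+ trunc_log 2 h * D <= h%:R * D.
    by rewrite ler_pM2r // -natrX ler_nat.
  have := far_split_gain_lt (xE w) p0 ph h0 jh j_gt j_lt tD small static.
  by rewrite ltNge gain_le.
have [jj|jj] := leqP j0 j.
  left; apply: (key pr (j - j0)%N); rewrite /pr ?addn0 ?subnKC //.
  by rewrite -natrB // ger0_norm.
right; apply: (key pl (j0 - j)%N); rewrite /pl ?subn0 ?subKn 1?ltnW //.
by rewrite distrC -natrB 1?ltnW // ger0_norm.
Qed.

End panel.

(** * The theorem *)

Lemma euclidean_norm_gt0 (R : realType) (m : nat) (v : 'rV[R]_m) (k : 'I_m) :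
  v 0 k != 0 -> 0 < euclidean_norm v ^+ 2.
Proof.
move=> vk; rewrite sqr_sqrtr; last by apply: sumr_ge0 => i _; exact: sqr_ge0.
rewrite (bigD1 k) //=; apply: ltr_wpDr.
  by apply: sumr_ge0 => i _; exact: sqr_ge0.
by rewrite lt_neqAle eq_sym sqrf_eq0 vk sqr_ge0.
Qed.

Theorem theorem2p5 (d : measure_display) (T : measurableType d)
  (R : realType) (P : probability T R)
  (c : R) (m : nat -> nat) (tau : nat -> R)
  (mu1 mu2 : forall n : nat, 'rV[R]_(m n))
  (Y : nat -> int -> {RV P >-> R})
  (X : forall n : nat, 'I_(m n) -> nat -> {RV P >-> R})
  (tau_hat : nat -> {RV P >-> R})
  (c_gt0 : 0 < c)
  (hD1 : D1 c tau mu1 mu2 Y X)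
  (hD2 : D2 Y)
  (hSNR1 : (fun n : nat =>
      n%:R * (m n)%:R^-1 * euclidean_norm (mu1 n - mu2 n) ^+ 2) @ \oo --> +oo)
  (h_lse : \forall n \near \oo, forall w : T,
      is_lse c n (fun k t => X n k t w) (tau_hat n w)) :
  bounded_in_probability P (fun n w =>
    n%:R * euclidean_norm (mu1 n - mu2 n) ^+ 2 * (tau_hat n w - tau n)).
Proof.
have [Ystat Yindep hX] := hD1.
have [C C0 hC] := noise_sum_moment4 Ystat hD2.
have [K K0 hK] := noise_sum_cov Ystat hD2.
(* A is rescaled by the constant of the chaining weights *)
have [A A0 AE] : exists2 A : R, 0 <= A & A / 1000 = C.
  have thousand : (1000 : R) != 0 by rewrite pnatr_eq0.
  exists (C * 1000); first exact: mulr_ge0 C0 (ler0n R 1000).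
  by rewrite (mulfK thousand).
rewrite -AE in hC; clear AE.
move=> eps eps0.
pose theta : R := c ^+ 3 / 32.
have theta0 : 0 < theta by rewrite divr_gt0 // exprn_gt0.
pose G := level_const c A; have G0 : 0 <= G by exact: level_const_ge0.
(* K1 makes the geometric tails small, B the terms in m / (n D) *)
pose K1 : R := 2 + 16 * G / eps.
have K1_ge2 : 2 <= K1.
  rewrite lerDl; apply: divr_ge0; last exact: ltW.
  exact: mulr_ge0 (ler0n R 16) G0.
have K1p : 0 < K1 by apply: lt_le_trans K1_ge2; rewrite ltr0n.
pose M : R := 2 * (1 + 16 * A) / theta ^+ 2 + 4 * G.
have M0 : 0 <= M.
  apply: addr_ge0; last exact: mulr_ge0.
  by apply: divr_ge0; [lra|exact: sqr_ge0].
pose B : R := 1 + 8 * (1 + A) / theta + 8 * K / theta + 2 * M / eps.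
have b1 : 0 <= 8 * (1 + A) / theta.
  by rewrite divr_ge0 ?(ltW theta0) // mulr_ge0 //; lra.
have b2 : 0 <= 8 * K / theta by rewrite divr_ge0 ?(ltW theta0) // mulr_ge0.
have b3 : 0 <= 2 * M / eps by rewrite divr_ge0 ?(ltW eps0) // mulr_ge0.
have /cvgryPge/(_ B) hB := hSNR1.
exists K1 => //.
near=> n.
have [[[j0 /andP[j0_gt0 j0n] tauE] tau_c] [k0 mu_k0] XE] : [/\
    time_grid n (tau n) /\ c < tau n < 1 - c,
    exists k, mu1 n 0 k != mu2 n 0 k
  & forall k t w, (1 <= t <= n)%N ->
      X n k t w = mu1 n 0 k * (t%:R <= n%:R * tau n)%R%:R
                  + mu2 n 0 k * (n%:R * tau n < t%:R)%R%:R
                  + Y (k : nat) (t : int) w].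
  by near: n.
have lse w : is_lse c n (fun k t => X n k t w) (tau_hat n w) by move: w; near: n.
have snr : B <= n%:R * (m n)%:R^-1 * euclidean_norm (mu1 n - mu2 n) ^+ 2.
  by near: n.
have n0 : (0 < n)%N by exact: leq_trans j0n.
have nr : 0 < n%:R :> R by rewrite ltr0n.
have m0 : (0 < m n)%N by apply: leq_ltn_trans (ltn_ord k0).
have mr : 0 < (m n)%:R :> R by rewrite ltr0n.
pose delta (k : nat) : R :=
  oapp (fun i : 'I_(m n) => mu1 n 0 i - mu2 n 0 i) 0 (insub k).
have deltaE (k : 'I_(m n)) : delta k = mu1 n 0 k - mu2 n 0 k.
  by rewrite /delta valK.
have DE : euclidean_norm (mu1 n - mu2 n) ^+ 2 = \sum_(k < m n) delta k ^+ 2.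
  rewrite sqr_sqrtr; last by apply: sumr_ge0 => i _; exact: sqr_ge0.
  by apply: eq_bigr => k _; rewrite deltaE !mxE.
have D0 : 0 < euclidean_norm (mu1 n - mu2 n) ^+ 2.
  by apply: (@euclidean_norm_gt0 _ _ _ k0); rewrite !mxE subr_eq0.
rewrite DE in snr D0 *.
set D := \sum_(k < m n) delta k ^+ 2 in snr D0 *.
have nD : 0 < n%:R * D by exact: mulr_gt0.
have snr' : B * (m n)%:R <= n%:R * D.
  move: snr; have -> : n%:R * (m n)%:R^-1 * D = n%:R * D / (m n)%:R by ring.
  by rewrite ler_pdivlMr.
have part (b t : R) : 0 < t -> b / t <= B -> b * (m n)%:R <= t * (n%:R * D).
  move=> t0 bB; have := le_trans (ler_wpM2r (ltW mr) bB) snr'.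
  have -> : b * (m n)%:R = t * (b / t * (m n)%:R) by field; rewrite gt_eqF.
  by rewrite ler_pM2l.
have BE : B = 1 + 8 * (1 + A) / theta + 8 * K / theta + 2 * M / eps by [].
have snr1 : (m n)%:R <= n%:R * D.
  rewrite -[leLHS]mul1r -[leRHS]mul1r; apply: part => //.
  by rewrite BE divr1; move: b1 b2 b3; clear; lra.
have snr2 : 8 * (1 + A) * (m n)%:R <= theta * (n%:R * D).
  by apply: part => //; rewrite BE; move: b1 b2 b3; clear; lra.
have snr3 : 8 * K * (m n)%:R <= theta * (n%:R * D).
  by apply: part => //; rewrite BE; move: b1 b2 b3; clear; lra.
have rho : M * ((m n)%:R / (n%:R * D)) <= eps / 2.
  have : 2 * M * (m n)%:R <= eps * (n%:R * D).
    by apply: part => //; rewrite BE; move: b1 b2 b3; clear; lra.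
  rewrite (mulrA M) (ler_pdivrMr _ _ nD); by clear; lra.
have [j0_gt j0_lt] : c * n%:R < j0%:R /\ c * n%:R < n%:R - j0%:R.
  move: tau_c; rewrite tauE ltr_pdivlMr // ltr_pdivrMr // mulrBl mul1r.
  by move=> /andP[]; clear; lra.
have xE w (k : 'I_(m n)) u : (1 <= u <= n)%N ->
    X n k u w = panel_obs Y j0 (mu1 n 0) (mu2 n 0) w k u.
  move=> hu; rewrite XE // /panel_obs.
  have -> : n%:R * tau n = j0%:R by rewrite tauE; field; rewrite gt_eqF.
  by rewrite ler_nat ltr_nat.
have := lse_error_prob n0 c_gt0 j0_gt j0_lt deltaE D0 m0 Yindep Ystat A0 K0 hC hK
  snr1 snr2 snr3 K1_ge2 xE lse.
rewrite -/D -/theta -/G -tauE => h.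
apply: prob_le_measurable; last apply: prob_leW h.
  rewrite (_ : [set w | _] = setT `&`
     (fun w => `|n%:R * D * (tau_hat n w - tau n)|) @^-1` `]K1, +oo[).
    have mf : measurable_fun setT (fun w => `|n%:R * D * (tau_hat n w - tau n)|).
      apply: measurableT_comp => //; apply: measurable_funM => //.
      exact: measurable_funB.
    by apply: mf => //; exact: measurable_itv.
  by rewrite setTI; apply/seteqP; split => w /=; rewrite in_itv /= andbT.
have GK : 8 * (G / K1) <= eps / 2.
  have : 16 * G <= eps * K1.
    rewrite /K1 mulrDr; have -> : eps * (16 * G / eps) = 16 * G.
      by field; rewrite gt_eqF.
    by rewrite lerDr mulr_ge0 // ltW.
  move=> h16; rewrite mulrA ler_pdivrMr //; lra.
move: rho GK; rewrite /M.
set q := _ / (n%:R * D).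
by move=> hq hG; rewrite mulrDr; lra.
Unshelve. all: by end_near.
Qed.
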